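(* Let $k\ge3$ be an odd integer (which may vary with $z$). With the notation of the context, assume the following: 1. For any $x\ge1$ and any square-free integer $d\ge1$, $\sharp\mathcal A_d(x)=\frac{h(d)}{d}N(x)+r_d(x)$, where $h$ is a multiplicative function with $0\le h(n)\le n$ for all $n\ge1$ and $N(x)$ is a positive monotonic increasing function. 2. $\sigma_{\mathcal P}(z)\to\infty$ as $z\to\infty$. 3. For any sufficiently large $z$, $k\le\sigma_{\mathcal P}(z)^{2/3}$. 4. For every prime $p\in\mathcal P(z)$, $0\le\frac{h(p)}p\le\frac12$. 5. For any sufficiently large $z$ there is a prime $p^*\in\mathcal P(z)$ such that $\frac{h(p)}p\left(1-\frac{h(p)}p\right)\left(1-2\frac{h(p)}p\right)$ is monotonic decreasing in $p$ for $p\in\mathcal P(z)$, $p\ge p^*$; furthermore the set $\{p\in\mathcal P(z): p\ge p^*\}$ has at least $\frac{k-1}2$ elements. 6. Let $\pi_l(\mathcal P)$ denote the $l$th smallest prime in $\mathcal P(z)$ and write $p^*=\pi_{l^*}(\mathcal P)$. Then $\pi_{l^*+\frac{k-3}2}(\mathcal P)\in\mathcal P(z)$ (i.e. this prime exists) and $l^*=O(k)$. 7. With $\tilde\sigma_{\mathcal P}(z):=\left(\sum_{p\in\mathcal P(z)}\left(\frac{h(p)}p\right)^2\left(1-\frac{h(p)}p\right)\right)^{1/2}$, there is an absolute constant $c_1>0$ with $\tilde\sigma_{\mathcal P}(z)\le c_1$. Then for sufficiently large $x\ge1$ and $z\ge1$, uniformly in $k$, $z$ and $x$, $$\begin{aligned}\sum_{a\in\mathcal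 A(x)}(\omega_{\mathcal P}(a)-\mu_{\mathcal P}(z))^k&=\tilde C_kN(x)\sigma_{\mathcal P}(z)^{k-1}+O\left((k^{3/2}C_k)N(x)\sigma_{\mathcal P}(z)^{k-3}k^3\right)\\&\quad+O\left(\mu_{\mathcal P}(z)^k\sum_{d\in\mathcal D_k(\mathcal P)}|r_d(x)|\right).\end{aligned}$$
   Context: For real $x\ge1$, $\mathcal A(x)=\{a_n\}$ is a finite sequence, possibly depending on $x$, of natural numbers, not necessarily distinct (sums over $a\in\mathcal A(x)$ are taken with multiplicity), with $\sharp\mathcal A(x)\to\infty$ as $x\to\infty$. For real $z\ge1$, $\mathcal P(z)$ is a finite set of primes with $\sharp\mathcal P(z)\to\infty$ as $z\to\infty$; write $\mathcal P=\mathcal P(z)$. For square-free $d\ge1$, $\mathcal A_d(x):=\{a_n\in\mathcal A(x): d\mid a_n\}$ (counted with multiplicity). For a natural number $a$, $\omega_{\mathcal P}(a):=\sum_{p\mid a,\ p\in\mathcal P(z)}1$. With $h$ the multiplicative function of assumption 1, $$\mu_{\mathcal P}(z):=\sum_{p\in\mathcal P(z)}\frac{h(p)}p,\qquad\sigma_{\mathcal P}(z):=\left(\sum_{p\in\mathcal P(z)}\frac{h(p)}p\left(1-\frac{h(p)}p\right)\right)^{1/2}.$$ $\mathcal D_k(\mathcal P)$ is the set of all square-free integers, including $1$, which are products of at most $k$ primes in $\mathcal P(z)$. $C_j:=\dfrac{\Gamma(j+1)}{2^{j/2}\Gamma(\frac j2+1)}$ for $j\ge1$, and $\tilde C_j:=\dfrac{2^{\frac{j-1}2}(j-1)}{3\sqrt\pi}\Gamma\left(\frac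 j2+1\right)$ for $j\ge3$. Uniformity means that the implied constants do not depend on $k,z,x$ (they may depend on $c_1$ and on the implied constant in $l^*=O(k)$). *)

(* Defs.v *)
From HB Require Import structures.
From mathcomp Require Import all_boot all_order all_algebra finmap.
From mathcomp Require Import all_classical all_reals all_analysis.

Set Implicit Arguments.
Unset Strict Implicit.
Unset Printing Implicit Defensive.

Import Order.TTheory GRing.Theory Num.Theory.
Import numFieldNormedType.Exports.

Local Open Scope classical_set_scope.
Local Open Scope ring_scope.

Definition Gamma (R : realType) (s : R) : R :=
  (\int[lebesgue_measure]_(t in `]0%R, +oo[) (t `^ (s - 1) * expR (- t)))%R.

Definition momentC (R : realType) (j : nat) : R :=
  Gamma (j%:R + 1) / (2 `^ (j%:R / 2) * Gamma (j%:R / 2 + 1)).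

Definition momentCtilde (R : realType) (j : nat) : R :=
  2 `^ ((j%:R - 1) / 2) * (j%:R - 1) / (3 * Num.sqrt pi)
  * Gamma (j%:R / 2 + 1).

Definition squarefree (d : nat) : Prop :=
  (0 < d)%N /\ forall m : nat, (m ^ 2 %| d)%N -> m = 1%N.

(* Multiplicativity on the positive integers; the value at 0 is irrelevant. *)
Definition multiplicative_fun (R : realType) (h : nat -> R) : Prop :=
  h 1%N = 1 /\
  forall m n : nat, (0 < m)%N -> (0 < n)%N -> coprime m n ->
    h (m * n)%N = h m * h n.

Definition omega (P : {fset nat}) (a : nat) : nat :=
  (\sum_(p <- P | p %| a) 1)%N.

Definition mu (R : realType) (h : nat -> R) (P : {fset nat}) : R :=
  \sum_(p <- P) h p / p%:R.

Definition sigma (R : realType) (h : nat -> R) (P : {fset nat}) : R :=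
  Num.sqrt (\sum_(p <- P) h p / p%:R * (1 - h p / p%:R)).

Definition sigma_tilde (R : realType) (h : nat -> R) (P : {fset nat}) : R :=
  Num.sqrt (\sum_(p <- P) (h p / p%:R) ^+ 2 * (1 - h p / p%:R)).

(* The l-th smallest element of P, with l starting from 1. The result is 0,
   which is not a prime, when l = 0 or l exceeds the cardinality of P. *)
Definition nth_smallest (P : {fset nat}) (l : nat) : nat :=
  nth 0%N (0%N :: sort leq P) l.

Definition Dset (k : nat) (P : {fset nat}) : set nat :=
  [set d | squarefree d /\
    exists s : seq nat,
      [/\ (size s <= k)%N, {subset s <= P} & d = (\prod_(p <- s) p)%N]].

(* A sum over a classical set is 0 by convention when infinitely many terms
   are nonzero; this lemma shows that sums over [Dset k P] are genuine. *)
Lemma finite_Dset (k : nat) (P : {fset nat}) : finite_set (Dset k P).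
Proof.
pose M := (\max_(p <- P) p).+1.
apply: (@sub_finite_set _ _ `I_(M ^ k).+1); last exact: finite_II.
move=> d [_ [s [sk sP ->]]] /=; rewrite ltnS.
apply: (@leq_trans (M ^ size s)); last by rewrite leq_pexp2l.
elim: s sP {sk} => [|p s IH] sP; first by rewrite big_nil.
rewrite big_cons expnS leq_mul //.
- by rewrite leqW //; apply: leq_bigmax_seq => //; apply: sP; rewrite mem_head.
- by apply: IH => q qs; apply: sP; rewrite in_cons qs orbT.
Qed.

(* Main.v *)
(* Expanding (omega - mu)^k and counting with assumption 1, the left side is
   N(x) E(S^k) plus a remainder, where S is a sum of independent centred Bernoulli
   variables of parameters q_p = h(p)/p. In the remainder each |r_d| has weight at most
   (mu + k)^k, which is O(mu^k) because k^2 <= k^3 <= sigma^2 <= mu.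

   E(S^k)/k! is the coefficient of X^k in the product of the generating functions f_p of
   the factors. Dividing f_p by the Gaussian factor exp(v_p X^2/2), v_p = q_p(1 - q_p),
   leaves 1 + kappa_p X^3/6 + (higher order). With V = sigma^2 and k = 2n + 3, multiply
   these out: as k is odd, the even powers X^4 and X^6 contribute nothing against
   exp(V X^2/2), the term in X^3 gives the main term (V/2)^n/n! * sum kappa_p/6, and all
   the rest is estimated by the weighted norm sum_i |p_i| rho^i at the saddle point
   rho^2 = (k - 1)/V, where it is O(k^3 (V/2)^n/n!). Finally sum kappa_p is
   V - 2 sigma~^2. *)
Require Import Defs.
From HB Require Import structures.
From mathcomp Require Import all_boot all_order all_algebra finmap.
From mathcomp Require Import all_classical all_reals all_analysis.
From mathcomp Require Import measurable_realfun lra ring.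

Set Implicit Arguments.
Unset Strict Implicit.
Unset Printing Implicit Defensive.

Import Order.TTheory GRing.Theory Num.Theory.
Import numFieldNormedType.Exports.

Local Open Scope classical_set_scope.
Local Open Scope ring_scope.

(** * The Gamma function *)

Section GammaFunction.
Variable R : realType.
Notation leb := (@lebesgue_measure R).

(** Monotone convergence. It carries identities proved on compact segments over to the half line;
    the endpoints stay general because the substitution in [Gamma_half] squares them. *)
Lemma cvg_integral_exhaust (f : R -> R) (a b : R^nat) :
  (forall n, 0 < a n) -> nonincreasing_seq a -> nondecreasing_seq b ->
  a n @[n --> \oo] --> 0 -> b n @[n --> \oo] --> +oo ->
  measurable_fun [set: R] f -> (forall x, 0 <= f x) ->
  (\int[leb]_(x in `[a n, b n]) (f x)%:E)%E @[n --> \oo] -->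
  (\int[leb]_(x in `]0%R, +oo[) (f x)%:E)%E.
Proof.
move=> a0 ani bnd acv bcv mf f0.
have -> : `]0%R, +oo[%classic = \bigcup_n `[a n, b n]%classic :> set R.
  apply/seteqP; split=> [x|x [n _]] /=; rewrite !in_itv/= ?andbT.
    move=> x0; near (\oo : set_system nat) => n; exists n => //=.
    rewrite in_itv/=; apply/andP; split; near: n.
      by move/cvgr_lt : acv => /(_ _ x0); apply: filterS => n; exact: ltW.
    by move/cvgryPge : bcv; exact.
  by move=> /andP[+ _]; exact: lt_le_trans.
apply: ge0_nondecreasing_set_cvg_integral => //.
- move=> m n mn; rewrite subsetEset; apply: subset_itv; rewrite bnd_simp.
    exact: ani.
  exact: bnd.
- by move=> n; apply/measurable_EFinP; apply: measurable_funS mf.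
- by move=> n x _; rewrite lee_fin.
Unshelve. all: by end_near. Qed.

Let G (s x : R) : R := x `^ (s - 1) * expR (- x).

Let G_ge0 s x : 0 <= G s x.
Proof. by rewrite mulr_ge0// ?powR_ge0// expR_ge0. Qed.

Let measurable_G s : measurable_fun [set: R] (G s).
Proof.
apply: measurable_funM => //.
by apply: measurableT_comp => //; exact: measurableT_comp.
Qed.

Let is_derive_NexpN (x : R) : is_derive x 1 (fun x => - expR (- x)) (expR (- x)).
Proof.
apply: is_derive_eq.
by rewrite /GRing.scale/= mulrN1 opprK.
Qed.

Lemma cvg_powR_expRN (s : R) : x `^ s * expR (- x) @[x --> +oo] --> 0.
Proof.
(* With an integer [m] above |s|, the bound exp x >= x^(m+1)/(m+1)! makes the function at most
   (m+1)!/x for x >= 1. *)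
pose m := (Num.truncn `|s|).+1.
apply: (@squeeze_cvgr _ _ _ _ (fun=> 0) (fun x => m.+1`!%:R * x^-1)).
- near=> x; rewrite mulr_ge0 ?powR_ge0 ?expR_ge0//=.
  have x1 : 1 <= x by near: x; exact: nbhs_pinfty_ge.
  have x0 : 0 < x by apply: lt_le_trans x1.
  have hm : x `^ s <= x ^+ m.
    rewrite -powR_mulrn; last exact: ltW.
    apply: ler_powR => //.
    apply: (le_trans (ler_norm _)); apply: ltW.
    by rewrite /m truncnS_gt.
  rewrite expRN ler_pdivrMr ?expR_gt0// mulrAC ler_pdivlMr//.
  have := expR_ge1Dxn m (ltW x0) => h.
  have {h} h : x ^+ m.+1 <= m.+1`!%:R * expR x.
    rewrite mulrC -ler_pdivrMr ?ltr0n ?fact_gt0//; apply: le_trans h.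
    by rewrite lerDr.
  by apply: le_trans h; rewrite exprSr ler_pM2r.
- exact: cvg_cst.
- rewrite -[X in _ --> X](mulr0 (m.+1`!%:R)); apply: cvgMr.
  apply/gtr0_cvgV0; first exact: nbhs_pinfty_gt.
  exact: cvg_id.
Unshelve. all: by end_near. Qed.

Let aN (n : nat) : R := n.+1%:R^-1.
(** The shift by 2 gives aN n <= 1 < bN n already at n = 0. *)
Let bN (n : nat) : R := n.+2%:R.
Let aN0 n : 0 < aN n. Proof. by rewrite invr_gt0. Qed.
Let aN_ni : nonincreasing_seq aN.
Proof. by move=> m n mn; rewrite lef_pV2 ?posrE// ler_nat. Qed.
Let bN_nd : nondecreasing_seq bN.
Proof. by move=> m n mn; rewrite ler_nat. Qed.
Let aN_cv : aN n @[n --> \oo] --> 0.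
Proof. exact: cvg_harmonic. Qed.
Let bN_cv : bN n @[n --> \oo] --> +oo.
Proof.
apply/cvgryPge => A; near=> n.
have [A0|A0] := leP A 0; first by apply: le_trans A0 _.
apply: (@le_trans _ _ n%:R); last by rewrite ler_nat -addn2 leq_addr.
near: n; exact: nbhs_infty_ger.
Unshelve. all: by end_near. Qed.
Let aN_lt_bN n : aN n < bN n.
Proof.
apply: (@le_lt_trans _ _ 1); last by rewrite ltr1n.
by rewrite invf_le1// ler1n.
Qed.

Let itvN_gt0 n x : x \in `[aN n, bN n] -> 0 < x.
Proof. by rewrite in_itv/= => /andP[+ _]; exact: lt_le_trans. Qed.

Let derivable_oo_of (f df : R -> R) (n : nat) :
  (forall x : R, 0 < x -> is_derive x 1 f (df x)) ->
  derivable_oo_LRcontinuous f (aN n) (bN n) /\ {in `]aN n, bN n[, f^`()%classic =1 df}.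
Proof.
move=> fE.
have cf (x : R) : 0 < x -> {for x, continuous f}.
  move=> x0; apply: differentiable_continuous; apply/derivable1_diffP.
  exact: (@ex_derive _ _ _ _ _ _ _ (fE x x0)).
have i0 (x : R) : x \in `]aN n, bN n[ -> 0 < x.
  by rewrite in_itv/= => /andP[+ _]; exact: lt_trans.
split; last first.
  by move=> x /i0 x0; rewrite derive1E; exact: (@derive_val _ _ _ _ _ _ _ (fE x x0)).
split.
- by move=> x /i0 x0; exact: (@ex_derive _ _ _ _ _ _ _ (fE x x0)).
- by apply: cvg_at_right_filter; apply: cf.
- by apply: cvg_at_left_filter; apply: cf; exact: lt_trans (aN_lt_bN n).
Qed.

Let integrable_segment (f : R -> R) (a b : R) :
  {within `[a, b], continuous f} -> leb.-integrable `[a, b] (fun x => (f x)%:E).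
Proof. by move=> cf; apply: continuous_compact_integrable => //; exact: segment_compact. Qed.

Let continuous_powR (r x : R) : 0 < x -> {for x, continuous (@powR R ^~ r)}.
Proof.
move=> x0; apply: differentiable_continuous; apply/derivable1_diffP.
exact: (@ex_derive _ _ _ _ _ _ _ (is_derive1_powR r x0)).
Qed.

(** Integration by parts on [aN n, bN n]; the boundary terms x^s exp(-x) tend to 0 at both ends, at
    0 because s > 0. The identity lives in the extended reals, so the integral may be infinite at
    this stage. *)
Lemma integral_GammaS (s : R) : 0 < s ->
  (\int[leb]_(x in `]0%R, +oo[) (x `^ s * expR (- x))%:E =
   s%:E * \int[leb]_(x in `]0%R, +oo[) (x `^ (s - 1) * expR (- x))%:E)%E.
Proof.
move=> s0.
have mG' := measurable_G (s + 1).
have := cvg_integral_exhaust aN0 aN_ni bN_nd aN_cv bN_cv mG' (G_ge0 (s + 1)).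
rewrite {1 2}/G addrK => h1.
have := cvg_integral_exhaust aN0 aN_ni bN_nd aN_cv bN_cv (measurable_G s) (G_ge0 s).
rewrite /G => h2.
have key n : (\int[leb]_(x in `[aN n, bN n]) (x `^ s * expR (- x))%:E =
   (aN n `^ s * expR (- aN n) - bN n `^ s * expR (- bN n))%:E +
   s%:E * \int[leb]_(x in `[aN n, bN n]) (x `^ (s - 1) * expR (- x))%:E)%E.
  have [d1 d1'] := @derivable_oo_of (@powR R ^~ s) (fun x => s * x `^ (s - 1)) n
    (fun x x0 => is_derive1_powR s x0).
  have [d2 d2'] := @derivable_oo_of (fun x => - expR (- x)) (fun x => expR (- x)) n
    (fun x _ => is_derive_NexpN x).
  have cE : {within `[aN n, bN n], continuous (fun x : R => expR (- x))}.
    apply: continuous_subspaceT => x.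
    by apply: continuous_comp; [exact: opp_continuous|exact: continuous_expR].
  have cP r : {within `[aN n, bN n], continuous (@powR R ^~ r)}.
    by apply: continuous_in_subspaceT => x /set_mem/= /itvN_gt0; exact: continuous_powR.
  have cP' : {within `[aN n, bN n], continuous (fun x => s * x `^ (s - 1))}.
    by move=> x; apply: cvgMr; exact: cP.
  rewrite (integration_by_parts (aN_lt_bN n) cP' d1 d1' cE d2 d2').
  congr (_ + _)%E; first by congr EFin; ring.
  rewrite -integralZl//; last first.
    apply: (@integrable_segment (fun x => x `^ (s - 1) * expR (- x))).
    by move=> x; apply: cvgM; [exact: cP|exact: cE].
  rewrite -integralN//; last first.
    apply: integrable_add_def => //.
    apply: (@integrable_segment (fun x => s * x `^ (s - 1) * - expR (- x))).
    by move=> x; apply: cvgM; [exact: cP'|apply: cvgN; exact: cE].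
  apply: eq_integral => x _; rewrite -EFinM -EFinN; congr EFin; ring.
suff h3 : (\int[leb]_(x in `[aN n, bN n]) (x `^ s * expR (- x))%:E)%E @[n --> \oo] -->
    (s%:E * \int[leb]_(x in `]0%R, +oo[) (x `^ (s - 1) * expR (- x))%:E)%E.
  exact: (cvg_unique _ h1 h3).
rewrite (funext key).
rewrite -[X in _ @[_ --> _] --> X]add0e.
apply: cvgeD => //.
- apply: cvg_EFin; first exact: nearW.
  rewrite -[X in _ --> X](subrr (0 : R)); apply: cvgB.
    rewrite -[X in _ --> X](mul0r (1 : R)); apply: cvgM.
      have /cvg_at_rightP := @powR_cvg0 R s s0; apply; split=> //.
    rewrite -(@expR0 R) -[X in expR X]oppr0.
    apply: continuous_cvg; first exact: continuous_expR.
    exact: cvgN.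
  exact: (cvg_comp _ _ bN_cv (@cvg_powR_expRN s)).
- by apply: cvgeZl.
Unshelve. all: by end_near. Qed.

Lemma GammaS (s : R) : 0 < s -> Gamma (s + 1) = s * Gamma s.
Proof.
move=> s0; rewrite /Gamma /Rintegral addrK integral_GammaS//.
(* The real-valued integral turns an infinite value into 0, on both sides alike. *)
case: (\int[_]_(x in _) _)%E => [r| |] //.
- by rewrite gt0_muley ?lte_fin//= mulr0.
- by rewrite gt0_muleNy ?lte_fin//= mulr0.
Qed.

Lemma Gamma1 : Gamma (1 : R) = 1.
Proof.
rewrite /Gamma /Rintegral.
have mf : measurable_fun [set: R] (fun t : R => expR (- t)).
  exact: measurableT_comp.
under eq_integral do rewrite subrr powRr0 mul1r.
rewrite integral_itv_obnd_cbnd; last first.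
  by apply/measurable_EFinP; exact: measurable_funS mf.
rewrite (@ge0_continuous_FTC2y R _ (fun x => - expR (- x)) 0 0).
- by rewrite /= oppr0 expR0 sub0r opprK.
- by move=> x _; exact: expR_ge0.
- apply: continuous_subspaceT => x.
  by apply: continuous_comp; [exact: opp_continuous|exact: continuous_expR].
- by rewrite -[X in _ --> X]oppr0; apply: cvgN; exact: cvgr_expR.
- by move=> x _; exact: (@ex_derive _ _ _ _ _ _ _ (is_derive_NexpN x)).
- apply: cvg_at_right_filter; apply: cvgN.
  by apply: continuous_comp; [exact: opp_continuous|exact: continuous_expR].
- by move=> x _; rewrite derive1E (@derive_val _ _ _ _ _ _ _ (is_derive_NexpN x)).
Qed.

(** The substitution t = x^2 gives twice the Gaussian integral over the half line, which is
    sqrt(pi)/2. *)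
Lemma Gamma_half : Gamma (2^-1 : R) = Num.sqrt pi.
Proof.
rewrite /Gamma /Rintegral.
have a0 n : 0 < aN n ^+ 2 by rewrite exprn_gt0.
have ani : nonincreasing_seq (fun n => aN n ^+ 2).
  by move=> m n mn; rewrite lerXn2r ?nnegrE ?(ltW (aN0 _))//; exact: aN_ni.
have bnd : nondecreasing_seq (fun n => bN n ^+ 2).
  by move=> m n mn; rewrite lerXn2r ?nnegrE ?ler0n//; exact: bN_nd.
have acv : aN n ^+ 2 @[n --> \oo] --> 0.
  by rewrite -[X in _ --> X](mulr0 (0 : R)); apply: cvgM.
have bcv : bN n ^+ 2 @[n --> \oo] --> +oo.
  exact: (cvg_comp _ _ bN_cv (@cvgr_expr2 R)).
have mG := measurable_G 2^-1.
have := cvg_integral_exhaust a0 ani bnd acv bcv mG (G_ge0 2^-1).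
rewrite {1 2}/G => h1.
have := cvg_integral_exhaust aN0 aN_ni bN_nd aN_cv bN_cv
  (@measurable_gauss_fun R) (@gauss_fun_ge0 R).
rewrite integral_itv_obnd_cbnd; last first.
  by apply/measurable_EFinP; exact: measurable_funS (@measurable_gauss_fun R).
rewrite integral0y_gauss => h2.
have key n : (\int[leb]_(x in `[(aN n ^+ 2)%R, (bN n ^+ 2)%R])
      (x `^ (2^-1 - 1) * expR (- x))%:E =
    2%:E * \int[leb]_(x in `[aN n, bN n]) (gauss_fun x)%:E)%E.
  have dF (x : R) : is_derive x 1 (fun x : R => x ^+ 2) (2 * x).
    by apply: is_derive_eq; rewrite /GRing.scale/=; ring.
  have [d1 d1'] := @derivable_oo_of (fun x : R => x ^+ 2) (fun x => 2 * x) n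
    (fun x _ => dF x).
  have dFE : ((fun x : R => x ^+ 2)^`())%classic = (fun x => 2 * x).
    by apply/funext => x; rewrite derive1E (@derive_val _ _ _ _ _ _ _ (dF x)).
  have c2 (x : R) : {for x, continuous (fun x : R => 2 * x)}.
    by apply: cvgMr; exact: cvg_id.
  rewrite (@integration_by_substitution_increasing R (fun x => x ^+ 2)
    (G 2^-1) (aN n) (bN n)).
  - rewrite -integralZl//; last first.
      apply: (@integrable_segment (@gauss_fun R)).
      by apply: continuous_subspaceT => x; exact: continuous_gauss_fun.
    apply: eq_integral => x /set_mem/= /itvN_gt0 x0.
    rewrite -EFinM; congr EFin.
    rewrite !fctE dFE /G /gauss_fun.
    rewrite -powR_mulrn ?ltW// -powRrM.
    have -> : 2%:R * (2^-1 - 1) = -1 :> R by field.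
    rewrite powRN powRr1 ?ltW// powR_mulrn ?ltW//.
    by rewrite mulrAC mulrCA mulVf ?gt_eqF// mulr1.
  - exact: ltW.
  - move=> x y /itvN_gt0 x0 /itvN_gt0 y0 xy.
    by rewrite ltrXn2r//; exact: ltW.
  - by rewrite dFE => x _; exact: c2.
  - by rewrite dFE; apply/cvg_ex; exists (2 * aN n); apply: cvg_at_right_filter; exact: c2.
  - by rewrite dFE; apply/cvg_ex; exists (2 * bN n); apply: cvg_at_left_filter; exact: c2.
  - by [].
  - apply: continuous_in_subspaceT => x /set_mem/=.
    rewrite in_itv/= => /andP[x0 _].
    have {}x0 : 0 < x by apply: lt_le_trans x0; rewrite exprn_gt0.
    have c3 : {for x, continuous (fun x : R => expR (- x))}.
      by apply: continuous_comp; [exact: opp_continuous|exact: continuous_expR].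
    exact: (cvgM (@continuous_powR (2^-1 - 1) _ x0) c3).
have h3 : (\int[leb]_(x in `[(aN n ^+ 2)%R, (bN n ^+ 2)%R])
      (x `^ (2^-1 - 1) * expR (- x))%:E)%E @[n --> \oo] -->
      (2%:E * (Num.sqrt pi / 2)%:E : \bar R)%E.
  by rewrite (funext key); apply: cvgeZl.
rewrite (cvg_unique _ h1 h3)//= mulrCA mulfV ?mulr1//.
Qed.

End GammaFunction.

(** * The constants [momentC] and [momentCtilde] at odd indices *)

Section MomentConstants.
Variable R : realType.

Lemma Gamma_nat (n : nat) : Gamma (n%:R + 1 : R) = n`!%:R.
Proof.
elim: n => [|n IH]; first by rewrite add0r Gamma1.
by rewrite GammaS ?ltr0n// -natr1 IH factS natrM natr1.
Qed.

Lemma Gamma_nat_half (n : nat) :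
  Gamma (n%:R + 2^-1 : R) = (n.*2)`!%:R / (4 ^+ n * n`!%:R) * Num.sqrt pi.
Proof.
elim: n => [|n IH]; first by rewrite add0r Gamma_half !fact0 expr0 mulr1 divr1 mul1r.
rewrite -natr1 addrAC GammaS; last by rewrite ltr_wpDl ?invr_gt0.
rewrite IH doubleS !factS !natrM exprS -!natr1 -muln2 natrM.
have n0 : n`!%:R != 0 :> R by rewrite pnatr_eq0 -lt0n fact_gt0.
have p0 : 4 ^+ n != 0 :> R by rewrite expf_neq0.
have n1 : n%:R + 1 != 0 :> R by rewrite natr1 pnatr_eq0.
by move: (4 ^+ n) p0 => Q p0; field; apply/and3P.
Qed.

(** For k = 2n + 3 the main term of E(S^k) is k! (V/2)^n/n! * V/6; this form shows that its constant
    is exactly [momentCtilde]. *)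
Lemma momentCtilde_odd (n : nat) :
  momentCtilde R n.*2.+3 = n.*2.+3`!%:R / (6 * (2 ^+ n * n`!%:R)).
Proof.
rewrite /momentCtilde.
have -> : (n.*2.+3%:R / 2 + 1 : R) = n.+2%:R + 2^-1.
  by rewrite -muln2 -(addn3 (n * 2)) -(addn2 n) !natrD natrM; field.
have -> : ((n.*2.+3%:R - 1) / 2 : R) = n.+1%:R.
  by rewrite -muln2 -(addn3 (n * 2)) -(addn1 n) !natrD natrM; field.
rewrite Gamma_nat_half powR_mulrn// !doubleS (factS n.*2.+3) !factS !exprS.
have E4 : 4 = 2 * 2 :> R by rewrite -natrM.
rewrite E4 exprMn.
have s0 : Num.sqrt pi != 0 :> R by rewrite gt_eqF// sqrtr_gt0 pi_gt0.
have n0 : n`!%:R != 0 :> R by rewrite pnatr_eq0 -lt0n fact_gt0.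
have p0 : 2 ^+ n != 0 :> R by rewrite expf_neq0.
have n1 : n%:R + 1 != 0 :> R by rewrite natr1 pnatr_eq0.
have n2 : n%:R + 2 != 0 :> R by rewrite -natrD pnatr_eq0 addn2.
rewrite !natrM -!natr1 -muln2 natrM.
move: (2 ^+ n) p0 => Q p0; field.
by do ?[apply/andP; split].
Qed.

(* The exponent 3 on the right is what makes the induction close:
   (1 + 3/(2n))^2 <= ((n+1)/n)^3. *)
Lemma Gamma_half_sqr_le (n : nat) :
  Gamma (n%:R + 2^-1 + 2 : R) ^+ 2 <= 3 * n.+1%:R ^+ 3 * n`!%:R ^+ 2.
Proof.
elim: n => [|n IH].
  rewrite add0r addrC Gamma_nat_half.
  rewrite exprMn sqr_sqrtr ?pi_ge0// fact0 expr1n !mulr1.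
  have := @pihalf_lt2 R.
  have -> : (2.*2)`! = 24%N by [].
  have -> : 2`! = 2%N by [].
  by move=> h; lra.
rewrite -natr1 [_ + 1 + _]addrAC [_ + 1 + 2]addrAC GammaS; last first.
  by rewrite ltr_wpDl ?addr_gt0 ?invr_gt0// addr_ge0.
rewrite exprMn factS natrM exprMn.
have fn : 0 <= n`!%:R ^+ 2 :> R by rewrite exprn_ge0.
have x0 : 0 <= n%:R :> R by [].
apply: (@le_trans _ _ ((n%:R + 2^-1 + 2) ^+ 2 * (3 * n.+1%:R ^+ 3 * n`!%:R ^+ 2))).
  by rewrite ler_wpM2l ?sqr_ge0.
rewrite -[n.+2%:R]natr1 -[n.+1%:R]natr1.
move: (n%:R : R) (n`!%:R : R) x0 fn => x f x0 fn; rewrite -subr_ge0.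
rewrite [leRHS](_ : _ = 3 * (x + 1) ^+ 2 * (3 / 4 * x + 7 / 4) * f ^+ 2); last by field.
rewrite mulr_ge0// mulr_ge0//; last by lra.
by rewrite mulr_ge0 ?sqr_ge0.
Qed.

(** Converts the natural size k!/(2^n n!) of the error into k^(3/2) C_k. With k! cancelled, the
    claim is 2^(n+3/2) Gamma(n+5/2) <= 7 k^(3/2) 2^n n!, which follows on squaring from
    [Gamma_half_sqr_le]. *)
Lemma momentC_odd_ge (n : nat) :
  n.*2.+3`!%:R / (2 ^+ n * n`!%:R) <=
  7 * (n.*2.+3%:R `^ (3 / 2) * momentC R n.*2.+3).
Proof.
rewrite /momentC Gamma_nat.
have k2 : (n.*2.+3%:R / 2 : R) = n%:R + 3 / 2.
  by rewrite -muln2 -(addn3 (n * 2)) !natrD natrM; field.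
have -> : (n.*2.+3%:R / 2 + 1 : R) = n%:R + 2^-1 + 2 by rewrite k2; field.
rewrite k2.
have f0 : 0 < n`!%:R :> R by rewrite ltr0n fact_gt0.
have p0 : 0 < 2 ^+ n :> R by rewrite exprn_gt0.
have P0 : 0 < 2 `^ (n%:R + 3 / 2) :> R by rewrite powR_gt0.
have g0 : 0 < Gamma (n%:R + 2^-1 + 2 : R).
  have -> : n%:R + 2^-1 + 2 = n.+2%:R + 2^-1 :> R by rewrite -(addn2 n) natrD; ring.
  rewrite Gamma_nat_half; apply: mulr_gt0; last by rewrite sqrtr_gt0 pi_gt0.
  apply: divr_gt0; first by rewrite ltr0n fact_gt0.
  by apply: mulr_gt0; [rewrite exprn_gt0|rewrite ltr0n fact_gt0].
have F0 : 0 < n.*2.+3`!%:R :> R by rewrite ltr0n fact_gt0.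
rewrite [leRHS]mulrA [leRHS]mulrCA ler_pM2l//.
rewrite ler_pdivlMr; last exact: mulr_gt0.
rewrite mulrC ler_pdivrMr; last exact: mulr_gt0.
set X := n.*2.+3%:R `^ (3/2).
have X0 : 0 <= X by rewrite powR_ge0.
have X2 : X ^+ 2 = n.*2.+3%:R ^+ 3.
  rewrite /X -powR_mulrn ?powR_ge0// -powRrM -powR_mulrn//.
  by congr (_ `^ _); field.
have P4 : 2 `^ (n%:R + 3 / 2) <= 2 ^+ n * 4 :> R.
  rewrite powRD; last by rewrite pnatr_eq0 implybT.
  rewrite powR_mulrn// ler_pM2l//.
  have -> : 4 = 2 `^ 2%:R :> R by rewrite powR_mulrn// -natrX.
  by apply: ler_powR; lra.
apply: (@le_trans _ _ (2 ^+ n * 4 * Gamma (n%:R + 2^-1 + 2))).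
  by rewrite ler_wpM2r// ltW.
rewrite -mulrA [leRHS]mulrCA ler_pM2l//.
rewrite -ler_sqr ?nnegrE; last 2 first.
- by rewrite mulr_ge0// ltW.
- by rewrite !mulr_ge0.
rewrite !exprMn X2.
apply: (@le_trans _ _ (4 ^+ 2 * (3 * n.+1%:R ^+ 3 * n`!%:R ^+ 2))).
  by rewrite ler_pM2l ?exprn_gt0// Gamma_half_sqr_le.
rewrite [leLHS]mulrA ler_wpM2r ?sqr_ge0//.
(* The constant 7 comes from 4^2 * 3 = 48 <= 7^2. *)
apply: (@le_trans _ _ (7 ^+ 2 * n.+1%:R ^+ 3)).
  by rewrite [leLHS]mulrA ler_wpM2r ?exprn_ge0// -!natrX -!natrM ler_nat.
rewrite ler_pM2l ?exprn_gt0// lerXn2r ?nnegrE// ler_nat.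
by rewrite ltnS -addnn -!addnS leq_addr.
Qed.

End MomentConstants.

(** * Truncated power series *)

Section PolyNorm.
Variable R : realType.
Implicit Types (p q : {poly R}) (rho c : R).

(** Weighted l1 norm of the coefficients. It is submultiplicative and bounds the i-th coefficient by
    the norm over rho^i, like a Cauchy estimate on the circle of radius [rho]. *)
Definition polynorm rho p : R := \sum_(i < size p) `|p`_i| * rho ^+ i.

Lemma polynormE (n : nat) rho p : (size p <= n)%N ->
  polynorm rho p = \sum_(i < n) `|p`_i| * rho ^+ i.
Proof.
move=> pn; rewrite /polynorm (big_ord_widen _ (fun i => `|p`_i| * rho ^+ i) pn).
rewrite [RHS](bigID (fun i : 'I_n => (i < size p)%N))/= [X in _ + X]big1 ?addr0//.
by move=> i; rewrite -leqNgt => pi; rewrite nth_default// normr0 mul0r.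
Qed.

Lemma polynorm_ge0 rho p : 0 <= rho -> 0 <= polynorm rho p.
Proof. by move=> r0; apply: sumr_ge0 => i _; rewrite mulr_ge0// exprn_ge0. Qed.

Lemma polynorm0 rho : polynorm rho 0 = 0.
Proof. by rewrite /polynorm size_poly0 big_ord0. Qed.

Lemma polynormD rho p q : 0 <= rho ->
  polynorm rho (p + q) <= polynorm rho p + polynorm rho q.
Proof.
move=> r0; set n := maxn (size p) (size q).
rewrite !(@polynormE n) ?leq_maxl ?leq_maxr ?size_polyD// -big_split/=.
apply: ler_sum => i _.
by rewrite coefD -mulrDl ler_wpM2r ?exprn_ge0// ler_normD.
Qed.

Lemma polynormN rho p : polynorm rho (- p) = polynorm rho p.
Proof.
by rewrite /polynorm size_polyN; apply: eq_bigr => i _; rewrite coefN normrN.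
Qed.

(** Horner step, the form that suits induction by [poly_ind]. *)
Lemma polynorm_cons rho p c :
  polynorm rho (p * 'X + c%:P) = polynorm rho p * rho + `|c|.
Proof.
rewrite (@polynormE (size p).+1); last first.
  by rewrite size_MXaddC; case: ifP.
rewrite big_ord_recl addrC expr0 mulr1 coefD coefMX coefC/= add0r.
congr (_ + _); rewrite /polynorm big_distrl/=; apply: eq_bigr => i _.
by rewrite coefD coefMX coefC/= addr0 exprSr mulrA.
Qed.

Lemma polynormC rho c : polynorm rho c%:P = `|c|.
Proof. by have := polynorm_cons rho 0 c; rewrite mul0r add0r polynorm0 mul0r add0r. Qed.

Lemma polynormMX rho p : polynorm rho (p * 'X) = polynorm rho p * rho.
Proof. by have := polynorm_cons rho p 0; rewrite normr0 !addr0. Qed.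

Lemma polynormMXn rho p (n : nat) : polynorm rho (p * 'X^n) = polynorm rho p * rho ^+ n.
Proof.
elim: n => [|n IH]; first by rewrite !expr0 !mulr1.
by rewrite !exprSr !mulrA polynormMX IH.
Qed.

Lemma polynormM rho p q : 0 <= rho ->
  polynorm rho (p * q) <= polynorm rho p * polynorm rho q.
Proof.
move=> r0; elim/poly_ind: p => [|p c IH]; first by rewrite mul0r polynorm0 mul0r.
rewrite mulrDl polynorm_cons mulrDl (le_trans (polynormD _ _ r0))//.
rewrite lerD//; first by rewrite mulrAC polynormMX mulrAC ler_wpM2r.
rewrite (@polynormE (size q)); last first.
  by rewrite mul_polyC size_scale_leq.
rewrite /polynorm big_distrr/=; apply: ler_sum => i _.
by rewrite coefCM normrM mulrA.
Qed.

Lemma polynorm_le1 rho p : 0 <= rho <= 1 -> polynorm rho p <= polynorm 1 p.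
Proof.
move=> /andP[r0 r1]; apply: ler_sum => i _.
by rewrite ler_wpM2l// expr1n exprn_ile1.
Qed.

(** At radius 1 the substitution only moves coefficients. Equality can fail for n = 0, where they
    collapse into one constant. *)
Lemma polynorm_compXn (n : nat) p : polynorm 1 (p \Po 'X^n) <= polynorm 1 p.
Proof.
elim/poly_ind: p => [|p c IH]; first by rewrite comp_poly0.
rewrite comp_polyD comp_polyM comp_polyX comp_polyC polynorm_cons mulr1.
rewrite (le_trans (polynormD _ _ ler01))// polynormC lerD2r.
by rewrite polynormMXn expr1n mulr1.
Qed.

(** The weights 1/2^(i+1) have partial sums below 1. This serves the tails of exponential series,
    through [invf_fact_le]. *)
Lemma polynorm_geometric (a : R) p : 0 <= a ->
  (forall i, `|p`_i| <= a / 2 ^+ i.+1) -> polynorm 1 p <= a.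
Proof.
move=> a0 pa; apply: (@le_trans _ _ (\sum_(i < size p) a / 2 ^+ i.+1)).
  by apply: ler_sum => i _; rewrite expr1n mulr1.
suff -> n : \sum_(i < n) a / 2 ^+ i.+1 = a - a / 2 ^+ n.
  by rewrite gerBl mulr_ge0// invr_ge0 exprn_ge0.
elim: n => [|n IH]; first by rewrite big_ord0 expr0 divr1 subrr.
rewrite big_ord_recr/= IH exprS.
have : 2 ^+ n != 0 :> R by rewrite expf_neq0.
by move: (2 ^+ n) => x x0; field.
Qed.

End PolyNorm.

(** * Polynomials as power series modulo X^(k+1) *)

Section TruncatedSeries.
Variable R : realType.
Implicit Types (p q : {poly R}) (a b v : R) (k n : nat).

(** Congruence modulo X^(k+1): generating functions are replaced by polynomials that are right to
    this order only. *)
Definition eq_upto k p q := forall i, (i <= k)%N -> p`_i = q`_i.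

Lemma eq_uptoM k p p' q q' :
  eq_upto k p p' -> eq_upto k q q' -> eq_upto k (p * q) (p' * q').
Proof.
move=> pp qq i ik; rewrite !coefM; apply: eq_bigr => j _.
rewrite pp ?qq//; first by rewrite (leq_trans _ ik)// leq_subr.
by rewrite (leq_trans _ ik)// -ltnS.
Qed.

Lemma eq_upto_trans k p q r : eq_upto k p q -> eq_upto k q r -> eq_upto k p r.
Proof. by move=> pq qr i ik; rewrite pq ?qr. Qed.

Lemma eq_upto_prod k (I : Type) (s : seq I) (F G : I -> {poly R}) :
  (forall i, eq_upto k (F i) (G i)) -> eq_upto k (\prod_(i <- s) F i) (\prod_(i <- s) G i).
Proof.
move=> FG; elim/big_rec2: _ => // i p q _ pq.
exact: eq_uptoM.
Qed.

Definition exp_trunc k a : {poly R} := \poly_(i < k.+1) (a ^+ i / i`!%:R).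

Lemma coef_exp_trunc k a i : (i <= k)%N -> (exp_trunc k a)`_i = a ^+ i / i`!%:R.
Proof. by move=> ik; rewrite coef_poly ltnS ik. Qed.

Lemma exp_trunc0 k : exp_trunc k 0 = 1.
Proof.
apply/polyP => -[|i]; rewrite coef_poly coefC/= ?expr0 ?fact0 ?divr1//.
by rewrite expr0n/= mul0r if_same.
Qed.

Lemma exp_truncD k a b :
  eq_upto k (exp_trunc k a * exp_trunc k b) (exp_trunc k (a + b)).
Proof.
move=> i ik; rewrite coef_exp_trunc// addrC exprDn big_distrl coefM/=.
apply: eq_bigr => j _; have ji : (j <= i)%N by rewrite -ltnS.
rewrite !coef_exp_trunc ?(leq_trans _ ik)// ?leq_subr//.
rewrite -mulr_natr -(bin_fact ji) !natrM.
have j0 : j`!%:R != 0 :> R by rewrite pnatr_eq0 -lt0n fact_gt0.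
have i0 : (i - j)`!%:R != 0 :> R by rewrite pnatr_eq0 -lt0n fact_gt0.
have c0 : 'C(i, j)%:R != 0 :> R by rewrite pnatr_eq0 -lt0n bin_gt0.
by field; apply/and3P.
Qed.

(** Stands for exp(v X^2/2). Modulo X^(k+1), the polynomials for v and -v are inverse to each
    other. *)
Definition gauss_trunc k v : {poly R} := exp_trunc k (v / 2) \Po 'X^2.

Lemma gauss_trunc0 k : gauss_trunc k 0 = 1.
Proof. by rewrite /gauss_trunc mul0r exp_trunc0 comp_polyC. Qed.

Lemma gauss_truncD k v w :
  eq_upto k (gauss_trunc k v * gauss_trunc k w) (gauss_trunc k (v + w)).
Proof.
move=> i ik; rewrite /gauss_trunc -comp_polyM !coef_comp_poly_Xn//.
case: ifP => // _; rewrite exp_truncD ?mulrDl//.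
by rewrite (leq_trans _ ik)// leq_div.
Qed.

Lemma coef_gauss_trunc_odd k v i : odd i -> (gauss_trunc k v)`_i = 0.
Proof. by move=> oi; rewrite coef_comp_poly_Xn// dvdn2 oi. Qed.

Lemma coef_gauss_trunc_double k v n : (n <= k)%N ->
  (gauss_trunc k v)`_(n.*2) = (v / 2) ^+ n / n`!%:R.
Proof.
move=> nk; rewrite coef_comp_poly_Xn// dvdn2 odd_double/= divn2 doubleK.
exact: coef_exp_trunc.
Qed.

End TruncatedSeries.

(** * The generating function of one centred Bernoulli variable *)

Section BernoulliFactor.
Variable R : realType.
Implicit Types (p : {poly R}) (q v : R) (k : nat).

(** Used to peel the X^4 coefficient off a remainder a X^4. *)
Lemma poly_splitX p : exists (c : R) (p' : {poly R}),
  [/\ p = p' * 'X + c%:P, polynorm 1 p' <= polynorm 1 p & `|c| <= polynorm 1 p].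
Proof.
elim/poly_ind: p => [|p c _].
  by exists 0, 0; rewrite mul0r add0r normr0 polynorm0.
exists c, p; rewrite polynorm_cons mulr1; split=> //; first by rewrite lerDl.
by rewrite lerDr polynorm_ge0.
Qed.

Lemma exp2_le_fact (n : nat) : (2 ^ n.+1 <= n.+2`!)%N.
Proof.
by elim: n => // n IH; rewrite expnS factS leq_mul.
Qed.

Lemma invf_fact_le (n m : nat) : (2 <= m)%N ->
  ((m + n)`!%:R)^-1 <= (2 ^+ n.+1)^-1 :> R.
Proof.
move=> m2; rewrite lef_pV2 ?posrE ?exprn_gt0 ?ltr0n ?fact_gt0//.
rewrite -natrX ler_nat (leq_trans (exp2_le_fact n))//.
by apply: leq_fact; rewrite -addn2 addnC leq_add2r.
Qed.

(** The j-th central moment of a Bernoulli variable of parameter [q]. *)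
Definition bernoulli_moment q (j : nat) : R := q * (1 - q) ^+ j + (1 - q) * (- q) ^+ j.

(** Once q(1 - q) is taken out, a convex combination of two numbers of absolute value at most 1
    remains. *)
Lemma bernoulli_moment_le q (j : nat) : 0 <= q <= 1 -> (2 <= j)%N ->
  `|bernoulli_moment q j| <= q * (1 - q).
Proof.
case: j => [|[|j]]// /andP[q0 q1] _.
have q1' : 0 <= 1 - q by rewrite subr_ge0.
have h1 : `|(1 - q) ^+ j| <= 1.
  by rewrite normrX ger0_norm// exprn_ile1// lerBlDr lerDl.
have h2 : `|(- q) ^+ j| <= 1 by rewrite normrX normrN ger0_norm// exprn_ile1.
rewrite /bernoulli_moment !exprS; move: (_ ^+ j) ((- q) ^+ j) h1 h2 => A B h1 h2.
have -> : q * ((1 - q) * ((1 - q) * A)) + (1 - q) * (- q * (- q * B))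
  = q * (1 - q) * ((1 - q) * A + q * B) by ring.
rewrite normrM ger0_norm ?mulr_ge0// ler_piMr ?mulr_ge0//.
rewrite -[leRHS](subrK q) (le_trans (ler_normD _ _))//.
by rewrite !normrM (ger0_norm q1') (ger0_norm q0) lerD// ler_piMr.
Qed.

(** Truncation of E exp((xi - q)X) for a Bernoulli variable xi of parameter [q]. *)
Definition bernoulli_trunc k q : {poly R} :=
  q%:P * exp_trunc k (1 - q) + (1 - q)%:P * exp_trunc k (- q).

Lemma coef_bernoulli_trunc k q i : (i <= k)%N ->
  (bernoulli_trunc k q)`_i = bernoulli_moment q i / i`!%:R.
Proof.
by move=> ik; rewrite coefD !coefCM !coef_exp_trunc// [RHS]mulrDl -!mulrA.
Qed.

Lemma coef_bernoulli_trunc_gt k q i : (k < i)%N -> (bernoulli_trunc k q)`_i = 0.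
Proof.
by move=> ik; rewrite coefD !coefCM !coef_poly ltnS leqNgt ik/= !mulr0 addr0.
Qed.

Lemma bernoulli_truncE k q : (3 <= k)%N -> 0 <= q <= 1 ->
  exists2 a : {poly R}, polynorm 1 a <= q * (1 - q) &
  bernoulli_trunc k q = 1 + (q * (1 - q) / 2)%:P * 'X^2
    + (q * (1 - q) * (1 - 2 * q) / 6)%:P * 'X^3 + a * 'X^4.
Proof.
move=> k3 q01; have [q0 q1] := andP q01.
have v0 : 0 <= q * (1 - q) by rewrite mulr_ge0 ?subr_ge0.
exists (drop_poly 4 (bernoulli_trunc k q)).
  apply: polynorm_geometric => // i; rewrite coef_drop_poly.
  have [ik|ik] := leqP (i + 4) k; last first.
    by rewrite coef_bernoulli_trunc_gt// normr0 mulr_ge0// invr_ge0 exprn_ge0.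
  rewrite coef_bernoulli_trunc// normrM normfV normr_nat.
  rewrite ler_pM ?invr_ge0//; first by rewrite bernoulli_moment_le// addnC.
  by rewrite addnC invf_fact_le.
have := @coef_bernoulli_trunc k q; move: (bernoulli_trunc k q) => f fE.
apply/polyP => i; rewrite !coefD coef1 !coefCM !coefXn coefMXn coef_drop_poly.
(* The central moments of order 0 to 3 are 1, 0, q(1 - q) and q(1 - q)(1 - 2q). *)
case: i => [|[|[|[|i]]]]/=; last by rewrite subnK// !mulr0 !add0r.
- by rewrite fE// /bernoulli_moment !expr0 !mulr0 !addr0 divr1; ring.
- by rewrite fE ?(leq_trans _ k3)// /bernoulli_moment !expr1 divr1; ring.
- by rewrite fE ?(leq_trans _ k3)// /bernoulli_moment -[2`!]/2%N; field.
- by rewrite fE// /bernoulli_moment -[3`!]/6%N; field.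
Qed.

Lemma gauss_truncE k v : (1 <= k)%N -> `|v| <= 1 ->
  exists2 b : {poly R}, polynorm 1 b <= `|v| &
  gauss_trunc k v = 1 + (v / 2)%:P * 'X^2 + b * 'X^4.
Proof.
move=> k1 v1; set w := v / 2.
have w1 : `|w| <= 1.
  by rewrite normrM normfV [X in _ / X]ger0_norm// ler_pdivrMr// mul1r (le_trans v1)// ler1n.
have wv : `|w| <= `|v|.
  by rewrite normrM normfV [X in _ / X]ger0_norm// ler_piMr// invf_le1// ler1n.
(* The tail of the exponential before X^2 is substituted for X. Its coefficients carry w^(i+2), at
   most |w| in absolute value since |w| <= 1. *)
pose d := drop_poly 2 (exp_trunc k w).
have eE : exp_trunc k w = 1 + w%:P * 'X + d * 'X^2.
  apply/polyP => i; rewrite !coefD coef1 !coefCM coefX coefMXn coef_drop_poly.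
  case: i => [|[|i]]/=; last by rewrite subnK// !mulr0 !add0r.
  - by rewrite coef_exp_trunc// expr0 fact0 mulr0 !addr0 divr1.
  - by rewrite coef_exp_trunc// expr1 divr1 mulr1 addr0 add0r.
exists (d \Po 'X^2); last first.
  rewrite /gauss_trunc -/w eE !comp_polyD !comp_polyM comp_polyX !comp_polyC.
  by rewrite -exprD.
rewrite (le_trans (polynorm_compXn _ _))//.
apply: polynorm_geometric => // i; rewrite coef_drop_poly coef_poly.
case: ifP => _; last by rewrite normr0 mulr_ge0// invr_ge0 exprn_ge0.
rewrite normrM normfV normr_nat ler_pM ?invr_ge0//.
  rewrite normrX addn2 exprS (le_trans _ wv)// ler_piMr// exprn_ile1//.
by rewrite addnC invf_fact_le.
Qed.

(** The X^4 coefficient is kept apart from the remainder [B]: an even power will drop out against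
    the Gaussian, so only X^5 and beyond has to be estimated. *)
Definition cubic_factor v (beta : R) p := exists (delta : R) (B : {poly R}),
  [/\ p = 1 + beta%:P * 'X^3 + delta%:P * 'X^4 + B * 'X^5,
      `|beta| <= v, `|delta| <= 3 * v & polynorm 1 B <= 7 * v].

(** The X^2 terms of the two factors are opposite and cancel. As v <= 1, every product of two small
    quantities is again at most v; the 3 and the 7 of [cubic_factor] count the summands of the two
    witnesses. *)
Lemma bernoulli_gauss_cubic k q : (3 <= k)%N -> 0 <= q <= 1 / 2 ->
  cubic_factor (q * (1 - q)) (q * (1 - q) * (1 - 2 * q) / 6)
    (bernoulli_trunc k q * gauss_trunc k (- (q * (1 - q)))).
Proof.
move=> k3 /andP[q0 q2]; set v := q * (1 - q).
have v0 : 0 <= v by rewrite mulr_ge0// subr_ge0; lra.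
have v1 : v <= 1 by rewrite /v; nra.
have q01 : 0 <= q <= 1 by rewrite q0/=; lra.
have [a ale ->] := bernoulli_truncE k3 q01.
have Nv1 : `|- v| <= 1 by rewrite normrN ger0_norm.
have [b ble ->] := gauss_truncE (leq_trans (isT : 1 <= 3)%N k3) Nv1.
rewrite -/v in ale *; rewrite normrN ger0_norm// in ble.
have [a0 [a' [aE a'le a0le]]] := poly_splitX a.
have [b0 [b' [bE b'le b0le]]] := poly_splitX b.
set al := v / 2; set be := v * _ / 6.
have alv : `|al| <= v by rewrite ger0_norm /al ?divr_ge0//; lra.
have bev : `|be| <= v.
  by rewrite /be ger0_norm; nra.
(* Coefficients of (1 + al X^2 + be X^3 + a X^4)(1 - al X^2 + b X^4), with a = a' X + a0 and b = b'
   X + b0. *)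
exists (- al ^+ 2 + b0 + a0),
  (b' + a' - (al * be)%:P + (al%:P * b - al%:P * a) * 'X + be%:P * b * 'X^2 + a * b * 'X^3).
have al2 : al ^+ 2 <= v by rewrite /al; nra.
have N := @polynorm_ge0 R 1.
have nD := fun p r : {poly R} => @polynormD R 1 p r ler01.
have nM := fun p r : {poly R} => @polynormM R 1 p r ler01.
split.
- rewrite mulNr -/al; move: al be {alv bev al2} => al be.
  rewrite !polyCD !polyCN !polyCM aE bE; ring.
- exact: bev.
- rewrite (le_trans (ler_normD _ _))// (le_trans (lerD (ler_normD _ _) (lexx _)))//.
  rewrite normrN normrX ger0_norm; last by rewrite /al divr_ge0.
  by lra.
- have h1 : polynorm 1 (al * be)%:P <= v.
    rewrite polynormC normrM (le_trans (ler_pM _ _ alv bev))//.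
    by rewrite ler_piMr.
  have mul_small c p1 : `|c| <= v -> polynorm 1 p1 <= v -> polynorm 1 (c%:P * p1) <= v.
    move=> cv pv; rewrite (le_trans (nM _ _))// polynormC (le_trans (ler_pM _ _ cv pv))// ?N//.
    by rewrite ler_piMr.
  have h2 := mul_small _ _ alv ble.
  have h3 := mul_small _ _ alv ale.
  have h4 := mul_small _ _ bev ble.
  have h5 : polynorm 1 (a * b) <= v.
    by rewrite (le_trans (nM _ _))// (le_trans (ler_pM _ _ ale ble)) ?N// ler_piMr.
  rewrite (le_trans (nD _ _))// polynormMXn expr1n mulr1.
  suff : polynorm 1 (b' + a' - (al * be)%:P + (al%:P * b - al%:P * a) * 'X
    + be%:P * b * 'X^2) <= 6 * v by lra.
  rewrite (le_trans (nD _ _))// polynormMXn expr1n mulr1.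
  suff : polynorm 1 (b' + a' - (al * be)%:P + (al%:P * b - al%:P * a) * 'X) <= 5 * v by lra.
  rewrite (le_trans (nD _ _))// polynormMX mulr1.
  have := nD (al%:P * b) (- (al%:P * a)); rewrite polynormN.
  suff : polynorm 1 (b' + a' - (al * be)%:P) <= 3 * v by lra.
  rewrite (le_trans (nD _ _))// polynormN.
  have := nD b' a'; lra.
Qed.

End BernoulliFactor.

(** * Expansion of a product of factors 1 + D_i *)

Section ProductExpansion.
Variables (R : realType) (I : Type).
Implicit Types (s : seq I) (D : I -> {poly R}) (rho : R).

(** The second elementary symmetric function of the D_i. *)
Fixpoint sum_pairs D s : {poly R} :=
  if s is x :: s' then sum_pairs D s' + D x * \sum_(i <- s') D i else 0.

(** Adding a factor 1 + D x turns each remainder into itself plus D x times the preceding remainder,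
    so the four bounds go through one induction. The exponential absorbs the new factor by 1 + d <=
    exp d. *)
Lemma prod_one_plus_bounds rho D (d : I -> R) s :
  0 <= rho -> (forall i, polynorm rho (D i) <= d i) ->
  let S := \sum_(i <- s) d i in
  let P := \prod_(i <- s) (1 + D i) in
  let E1 := \sum_(i <- s) D i in
  [/\ polynorm rho P <= expR S,
      polynorm rho (P - 1) <= S * expR S,
      polynorm rho (P - 1 - E1) <= S ^+ 2 * expR S &
      polynorm rho (P - 1 - E1 - sum_pairs D s) <= S ^+ 3 * expR S].
Proof.
move=> r0 Dd.
have d0 i : 0 <= d i by exact: le_trans (polynorm_ge0 _ r0) (Dd i).
elim: s => [|x s] /=.
  rewrite !big_nil !subr0 !subrr polynorm0 -[1]/(1%:P) polynormC normr1 expR0.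
  by rewrite !mul0r !expr0n.
rewrite !big_cons.
set S := \sum_(i <- s) d i; set P := \prod_(i <- s) _; set E1 := \sum_(i <- s) D i.
set E2 := sum_pairs D s; move=> [b0 b1 b2 b3].
have S0 : 0 <= S by exact: sumr_ge0.
have eS0 : 0 <= expR S by exact: expR_ge0.
have eS : expR S * (1 + d x) <= expR (d x + S).
  by rewrite [d x + S]addrC expRD ler_wpM2l// expR_ge1Dx.
have eS1 : expR S <= expR (d x + S) by rewrite ler_expR lerDr.
have step (p q : {poly R}) (u w : R) : polynorm rho p <= u * expR S -> 0 <= u ->
    polynorm rho q <= w * expR S -> 0 <= w ->
    polynorm rho (q + D x * p) <= (w + d x * u) * expR (d x + S).
  move=> pu u0 qw w0.
  rewrite (le_trans (polynormD _ _ r0))//.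
  apply: (@le_trans _ _ (w * expR S + d x * (u * expR S))).
    rewrite lerD// (le_trans (polynormM _ _ r0))// ler_pM// polynorm_ge0//.
  by rewrite mulrA -mulrDl ler_wpM2l// addr_ge0// mulr_ge0.
have dx := d0 x.
split.
- have -> : (1 + D x) * P = P + D x * P by ring.
  rewrite (le_trans (polynormD _ _ r0))// (le_trans _ eS)//.
  rewrite mulrDr mulr1 lerD// (le_trans (polynormM _ _ r0))// mulrC ler_pM ?polynorm_ge0//.
- have -> : (1 + D x) * P - 1 = (P - 1) + D x * P by ring.
  have := @step P (P - 1) 1 S; rewrite !mul1r mulr1 => /(_ b0 ler01 b1 S0).
  by rewrite addrC [S + _]addrC.
- have -> : (1 + D x) * P - 1 - (D x + E1) = (P - 1 - E1) + D x * (P - 1) by ring.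
  apply: le_trans (step _ _ _ _ b1 S0 b2 (sqr_ge0 _)) _.
  rewrite ler_wpM2r ?expR_ge0//; nra.
- have -> : (1 + D x) * P - 1 - (D x + E1) - (E2 + D x * E1)
      = (P - 1 - E1 - E2) + D x * (P - 1 - E1) by ring.
  apply: le_trans (step _ _ _ _ b2 (sqr_ge0 _) b3 _) _; first by rewrite exprn_ge0.
  rewrite ler_wpM2r ?expR_ge0//.
  have -> : (d x + S) ^+ 3 = S ^+ 3 + d x * S ^+ 2 +
      (d x ^+ 3 + 3 * d x ^+ 2 * S + 2 * d x * S ^+ 2) by ring.
  by rewrite lerDl !addr_ge0 ?mulr_ge0 ?exprn_ge0.
Qed.

(** Single terms give X^3, X^4 and a remainder from X^5; pairs give X^6 and a remainder from X^7;
    triples and beyond fall under S^3 exp S. [delta] and [gamma] carry no bound, as they sit on even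
    powers. *)
Lemma prod_cubic_factors rho (v beta : I -> R) (L : I -> {poly R}) s :
  0 < rho <= 1 -> (forall i, cubic_factor (v i) (beta i) (L i)) ->
  let V := \sum_(i <- s) v i in
  let S := 11 * V * rho ^+ 3 in
  exists (delta gamma : R) (T : {poly R}),
    \prod_(i <- s) L i = 1 + (\sum_(i <- s) beta i)%:P * 'X^3
      + delta%:P * 'X^4 + gamma%:P * 'X^6 + T /\
    polynorm rho T <= 7 * V * rho ^+ 5 + 120 * V ^+ 2 * rho ^+ 7 + S ^+ 3 * expR S.
Proof.
move=> /andP[rho0 rho1] cL V S.
have r0 := ltW rho0; have r01 : 0 <= rho <= 1 by rewrite r0.
have /choice[dB dBP] : forall i, exists dB : R * {poly R},
    [/\ L i = 1 + (beta i)%:P * 'X^3 + dB.1%:P * 'X^4 + dB.2 * 'X^5,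
      `|beta i| <= v i, `|dB.1| <= 3 * v i & polynorm 1 dB.2 <= 7 * v i].
  by move=> i; have [d [B H]] := cL i; exists (d, B).
pose D i := L i - 1.
have v0 i : 0 <= v i by case: (dBP i) => _ /(le_trans (normr_ge0 _)).
have nD := fun p r : {poly R} => @polynormD R 1 p r ler01.
have nM := fun p r : {poly R} => @polynormM R 1 p r ler01.
(* D_i = (beta_i + F_i X) X^3; F_i has norm at most (3 + 7) v_i, and the bracket at most 11 v_i. *)
pose F i := (dB i).1%:P + (dB i).2 * 'X.
have DE i : D i = ((beta i)%:P + F i * 'X) * 'X^3.
  by rewrite /D /F; case: (dBP i) => -> _ _ _; ring.
have F10 i : polynorm 1 (F i) <= 10 * v i.
  rewrite (le_trans (nD _ _))// polynormC polynormMX mulr1.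
  by case: (dBP i) => _ _ h1 h2; lra.
have E11 i : polynorm 1 ((beta i)%:P + F i * 'X) <= 11 * v i.
  rewrite (le_trans (nD _ _))// polynormC polynormMX mulr1.
  by case: (dBP i) => _ h1 _ _; have := F10 i; lra.
have Dd i : polynorm rho (D i) <= 11 * rho ^+ 3 * v i.
  rewrite DE polynormMXn mulrAC ler_wpM2r ?exprn_ge0//.
  exact: le_trans (polynorm_le1 _ r01) (E11 i).
have sF : polynorm 1 (\sum_(i <- s) F i) <= 10 * V.
  rewrite /V; elim: s {V S} => [|x s IH]; first by rewrite !big_nil polynorm0 mulr0.
  by rewrite !big_cons (le_trans (nD _ _))// mulrDr lerD.
have sB : polynorm 1 (\sum_(i <- s) (dB i).2) <= 7 * V.
  rewrite /V; elim: s {V S sF} => [|x s IH]; first by rewrite !big_nil polynorm0 mulr0.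
  by rewrite !big_cons (le_trans (nD _ _))// mulrDr lerD//; case: (dBP x).
have sD : \sum_(i <- s) D i = (\sum_(i <- s) beta i)%:P * 'X^3
    + (\sum_(i <- s) (dB i).1)%:P * 'X^4 + (\sum_(i <- s) (dB i).2) * 'X^5.
  rewrite !rmorph_sum/= !big_distrl/= -!big_split/=.
  by apply: eq_bigr => i _; rewrite DE /F; ring.
have [gamma [Q [QE Qle]]] : exists (gamma : R) (Q : {poly R}),
    sum_pairs D s = gamma%:P * 'X^6 + Q * 'X^7 /\ polynorm 1 Q <= 120 * V ^+ 2.
  rewrite /V; elim: s {V S sF sB sD} => [|x s [g [Q [QE Qle]]]].
    by exists 0, 0; rewrite /= !mul0r addr0 big_nil polynorm0 expr0n mulr0.
  rewrite /= big_cons.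
  have W0 : 0 <= \sum_(i <- s) v i by exact: sumr_ge0.
  have fb : `|\sum_(i <- s) beta i| <= \sum_(i <- s) v i.
    rewrite (le_trans (ler_norm_sum _ _ _))//; apply: ler_sum => i _.
    by case: (dBP i).
  have fF : polynorm 1 (\sum_(i <- s) F i) <= 10 * \sum_(i <- s) v i.
    elim: s {Q QE Qle W0 fb} => [|y s IH]; first by rewrite !big_nil polynorm0 mulr0.
    by rewrite !big_cons (le_trans (nD _ _))// mulrDr lerD.
  have fD : \sum_(i <- s) D i = ((\sum_(i <- s) beta i)%:P + (\sum_(i <- s) F i) * 'X) * 'X^3.
    rewrite !rmorph_sum/= big_distrl/= -big_split/= big_distrl/=.
    by apply: eq_bigr => i _; rewrite DE.
  rewrite QE fD DE.
  move: (\sum_(i <- s) beta i) (\sum_(i <- s) F i) (\sum_(i <- s) v i) W0 fb fF Qle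
    => b G W W0 fb fG Qle {fD QE}.
  (* Besides its X^6 term, the new product leaves beta_x G + F_x (b + G X), of norm at most (10 + 10
     * 11) v_x W: this is the 120. *)
  exists (g + beta x * b), (Q + ((beta x)%:P * G + F x * (b%:P + G * 'X))); split.
    by rewrite polyCD polyCM; ring.
  have h1 : polynorm 1 ((beta x)%:P * G) <= v x * (10 * W).
    rewrite (le_trans (nM _ _))// ler_pM ?polynorm_ge0//.
    by rewrite polynormC; case: (dBP x).
  have h2 : polynorm 1 (b%:P + G * 'X) <= 11 * W.
    by rewrite (le_trans (nD _ _))// polynormC polynormMX mulr1; lra.
  have h3 : polynorm 1 (F x * (b%:P + G * 'X)) <= (10 * v x) * (11 * W).
    by rewrite (le_trans (nM _ _))// ler_pM ?polynorm_ge0.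
  have := nD ((beta x)%:P * G) (F x * (b%:P + G * 'X)).
  have := nD Q ((beta x)%:P * G + F x * (b%:P + G * 'X)).
  have := v0 x; have := mulr_ge0 (v0 x) W0; nra.
have [_ _ _] := prod_one_plus_bounds s r0 Dd.
rewrite -big_distrr/= -/V -[11 * _ * V]mulrAC -/S.
have -> : \prod_(i <- s) (1 + D i) = \prod_(i <- s) L i.
  by apply: eq_bigr => i _; rewrite /D addrC subrK.
set P := \prod_(i <- s) L i => hT.
exists (\sum_(i <- s) (dB i).1), gamma,
  ((\sum_(i <- s) (dB i).2) * 'X^5 + Q * 'X^7 + (P - 1 - \sum_(i <- s) D i - sum_pairs D s)).
split; first by rewrite sD QE; ring.
rewrite (le_trans (polynormD _ _ r0))// lerD// (le_trans (polynormD _ _ r0))//.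
rewrite !polynormMXn lerD// ler_wpM2r ?exprn_ge0//.
  exact: le_trans (polynorm_le1 _ r01) sB.
exact: le_trans (polynorm_le1 _ r01) Qle.
Qed.

End ProductExpansion.

(** * Coefficients of a product with the Gaussian series *)

Section CoefficientBound.
Variable R : realType.
Implicit Types (V rho : R) (G : {poly R}) (n : nat).

(** With K = n + 1, the ratio of consecutive terms K^i/i! is K/(i + 1) >= 1 up to i = n, with
    equality there. *)
Lemma exp_div_fact_le n (m : nat) : (m <= n.+1)%N ->
  n.+1%:R ^+ m / m`!%:R <= n.+1%:R ^+ n / n`!%:R :> R.
Proof.
have f0 i : 0 < i`!%:R :> R by rewrite ltr0n fact_gt0.
have step i : (i < n.+1)%N ->
    n.+1%:R ^+ i / i`!%:R <= n.+1%:R ^+ i.+1 / i.+1`!%:R :> R.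
  move=> ilt; rewrite exprS factS natrM invfM mulrACA.
  rewrite ler_peMl// ?divr_ge0 ?exprn_ge0//.
  by rewrite ler_pdivlMr ?ltr0n// mul1r ler_nat.
have last_eq : n.+1%:R ^+ n.+1 / n.+1`!%:R = n.+1%:R ^+ n / n`!%:R :> R.
  by rewrite exprS factS natrM invfM mulrACA divff ?mul1r// pnatr_eq0.
rewrite -last_eq => mn; rewrite -(subKn mn).
elim: (n.+1 - m)%N => [|d IH]; first by rewrite subn0.
have [dn|dn] := ltnP d n.+1; last first.
  by move: IH; rewrite (eqP dn) (eqP (leqW dn)).
apply: le_trans IH; have -> : (n.+1 - d = (n.+1 - d.+1).+1)%N by rewrite subnSK.
by apply: step; rewrite ltn_subrL.
Qed.

Lemma polynorm_ge_sum rho G (m : nat) : 0 <= rho ->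
  \sum_(i < m) `|G`_i| * rho ^+ i <= polynorm rho G.
Proof.
move=> r0; rewrite (@polynormE _ (maxn (size G) m)) ?leq_maxl//.
rewrite (big_ord_widen _ (fun i => `|G`_i| * rho ^+ i) (leq_maxr (size G) m)).
rewrite [leRHS](bigID (fun i : 'I__ => (i < m)%N))/= lerDl.
by apply: sumr_ge0 => i _; rewrite mulr_ge0// exprn_ge0.
Qed.

(** At this radius V/2 = (n+1)/rho^2, so the Gaussian coefficient at X^(2m) is rho^(-2m) (n+1)^m/m!,
    and m = n maximises the second factor. Each G_j is thus charged with at most A rho^j. *)
Lemma coef_gauss_truncM_le n V rho G : 0 < rho -> rho ^+ 2 * V = n.*2.+2%:R ->
  `|(gauss_trunc n.*2.+3 V * G)`_n.*2.+3| <= (V / 2) ^+ n / n`!%:R / rho ^+ 3 * polynorm rho G.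
Proof.
move=> rho0 rhoV; set k := n.*2.+3; have r0 := ltW rho0; have rN0 : rho != 0 by rewrite gt_eqF.
have V2 : V / 2 = n.+1%:R / rho ^+ 2.
  have -> : n.+1%:R = rho ^+ 2 * V / 2 :> R.
    by rewrite rhoV -doubleS -muln2 natrM mulfK.
  by field.
set A := _ / rho ^+ 3.
have A0 : 0 <= A.
  rewrite /A V2 divr_ge0 ?exprn_ge0// divr_ge0// exprn_ge0// divr_ge0//.
  by rewrite exprn_ge0.
have AE : A = n.+1%:R ^+ n / n`!%:R / rho ^+ k.
  rewrite /A /k V2 exprMn exprVn -exprM -(addn3 n.*2) -muln2 [(n * 2)%N]mulnC exprD.
  have : rho ^+ (2 * n) != 0 by rewrite expf_neq0.
  have : n`!%:R != 0 :> R by rewrite pnatr_eq0 -lt0n fact_gt0.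
  move: (rho ^+ (2 * n)) (n`!%:R : R) (n.+1%:R ^+ n : R) => x y z x0 y0; field.
  by apply/and3P.
rewrite coefMr (le_trans (ler_norm_sum _ _ _))//.
apply: (@le_trans _ _ (\sum_(j < k.+1) A * (`|G`_j| * rho ^+ j))); last first.
  by rewrite -big_distrr/= ler_wpM2l// polynorm_ge_sum.
apply: ler_sum => -[j jk] _ /=; rewrite normrM mulrCA mulrC ler_wpM2l//.
have [ko|/even_halfK e] := boolP (odd (k - j)).
  by rewrite coef_gauss_trunc_odd// normr0 mulr_ge0// exprn_ge0.
set m := (k - j)./2 in e.
(* 2m = k - j <= 2n + 3, so m may reach n + 1, where the maximum is attained again. *)
have mn : (m <= n.+1)%N.
  by rewrite -ltnS -ltn_double e !doubleS ltnS (leq_trans (leq_subr _ _)).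
have mk : (m <= k)%N.
  by rewrite (leq_trans mn)// /k ltnS -addnn -!addnS leq_addr.
rewrite -e coef_gauss_trunc_double// ger0_norm; last first.
  by rewrite V2 divr_ge0// exprn_ge0// divr_ge0// exprn_ge0.
rewrite AE V2 exprMn exprVn -exprM mul2n e.
have jle : (j <= k)%N by rewrite -ltnS.
have -> : rho ^+ k = rho ^+ (k - j) * rho ^+ j by rewrite -exprD subnK.
have h := exp_div_fact_le mn.
have x0 : rho ^+ (k - j) != 0 by rewrite expf_neq0.
have y0 : rho ^+ j != 0 by rewrite expf_neq0.
rewrite [leRHS](_ : _ = n.+1%:R ^+ n / n`!%:R / rho ^+ (k - j)); last first.
  by rewrite invfM -!mulrA mulVf ?mulr1.
by rewrite mulrAC ler_wpM2r// invr_ge0 exprn_ge0.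
Qed.

End CoefficientBound.

(** * The coefficient of X^k in the full product *)

Section CentralMoment.
Variables (R : realType) (I : Type) (q : I -> R).
Hypothesis q_half : forall i, 0 <= q i <= 1 / 2.

Lemma prod_gauss_trunc k (v : I -> R) (s : seq I) :
  eq_upto k (\prod_(i <- s) gauss_trunc k (v i)) (gauss_trunc k (\sum_(i <- s) v i)).
Proof.
elim: s => [|x s IH]; first by rewrite !big_nil gauss_trunc0.
rewrite !big_cons; apply: eq_upto_trans (@gauss_truncD _ _ _ _).
exact: eq_uptoM.
Qed.

(* 7 and 120 are the constants of [prod_cubic_factors]; 1331 = 11 ^ 3 comes from its
   last term, where S <= 11. *)
Definition central_moment_const : R := 127 + 1331 * expR 11.

Lemma coef_prod_bernoulli_trunc (n : nat) (s : seq I) :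
  let k := n.*2.+3 in
  let V := \sum_(i <- s) q i * (1 - q i) in
  let a := (V / 2) ^+ n / n`!%:R in
  k%:R ^+ 3 <= V ->
  `|(\prod_(i <- s) bernoulli_trunc k (q i))`_k
     - a * \sum_(i <- s) q i * (1 - q i) * (1 - 2 * q i) / 6|
  <= central_moment_const * (k%:R ^+ 3 * a).
Proof.
move=> k V a kV.
pose v i := q i * (1 - q i).
pose L i := bernoulli_trunc k (q i) * gauss_trunc k (- v i).
have k1 : 1 <= k%:R :> R by rewrite ler1n.
have V1 : 1 <= V by apply: le_trans kV; rewrite exprn_ege1.
have V0 : 0 < V by apply: lt_le_trans V1.
pose rho : R := Num.sqrt (n.*2.+2%:R / V).
have rho0 : 0 < rho by rewrite sqrtr_gt0 divr_gt0.
have rho2 : rho ^+ 2 = n.*2.+2%:R / V by rewrite sqr_sqrtr// divr_ge0// ltW.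
have rhoV : rho ^+ 2 * V = n.*2.+2%:R by rewrite rho2 divfK// gt_eqF.
have Kk : n.*2.+2%:R <= k%:R :> R by rewrite ler_nat.
have rho1 : rho <= 1.
  rewrite -sqrtr1 ler_wsqrtr// ler_pdivrMr// mul1r (le_trans Kk)//.
  by rewrite (le_trans _ kV)// ler_eXnr.
have cL i : cubic_factor (v i) (q i * (1 - q i) * (1 - 2 * q i) / 6) (L i).
  exact: bernoulli_gauss_cubic.
have r01 : 0 < rho <= 1 by rewrite rho0.
have [delta [gamma [T [PE Tle]]]] := prod_cubic_factors s r01 cL.
(* The Gaussians for v_i and -v_i, which cancel modulo X^(k+1), are inserted in each factor; those
   for v_i multiply to the one for V. *)
have : eq_upto k (\prod_(i <- s) bernoulli_trunc k (q i))
    (gauss_trunc k V * \prod_(i <- s) L i).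
  apply: (@eq_upto_trans _ _ _ (\prod_(i <- s) (gauss_trunc k (v i) * L i))).
    apply: eq_upto_prod => i; rewrite /L mulrCA -[X in eq_upto _ X]mulr1.
    apply: eq_uptoM => // j jk.
    by rewrite gauss_truncD// subrr gauss_trunc0.
  rewrite big_split/=; apply: eq_uptoM => //.
  exact: prod_gauss_trunc.
move=> /(_ k (leqnn k)) ->; rewrite PE.
set beta := \sum_(i <- s) _.
have ok : odd k by rewrite /k/= negbK odd_double.
have cX (c : R) (m : nat) : (gauss_trunc k V * (c%:P * 'X^m))`_k =
    if (k < m)%N then 0 else c * (gauss_trunc k V)`_(k - m).
  by rewrite mulrCA coefCM coefMXn; case: ifP; rewrite ?mulr0.
rewrite !mulrDr !coefD mulr1 coef_gauss_trunc_odd// add0r !cX.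
have -> : (k - 3)%N = n.*2 by rewrite /k !subSS subn0.
have -> : (k < 3)%N = false by rewrite ltnNge.
rewrite coef_gauss_trunc_double; last first.
  by rewrite /k -addnn -!addnS leq_addr.
rewrite -/k [beta * _]mulrC -/a.
(* For [k] odd and [m] even, k - m is odd, and the Gaussian series has no odd powers. *)
have even_zero (c : R) (m : nat) : ~~ odd m ->
    (if (k < m)%N then 0 else c * (gauss_trunc k V)`_(k - m)) = 0.
  move=> em; case: ltnP => // mk; rewrite coef_gauss_trunc_odd ?mulr0//.
  by rewrite oddB// ok (negbTE em).
rewrite !even_zero// !addr0 [a * beta + _]addrC addrK.
have := coef_gauss_truncM_le T rho0 rhoV; rewrite /= -/k -/a => h.
apply: (le_trans h).
have a0 : 0 <= a by rewrite /a divr_ge0// exprn_ge0// divr_ge0// ltW.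
rewrite -mulrA [leRHS](_ : _ = a * (central_moment_const * k%:R ^+ 3)); last by ring.
rewrite ler_wpM2l// mulrC ler_pdivrMr ?exprn_gt0//.
apply: (le_trans Tle).
move: rhoV rho2 Kk; set K : R := n.*2.+2%:R => rhoV rho2 Kk.
have K1 : 1 <= K by rewrite ler1n.
have VE : \sum_(i <- s) v i = V by [].
rewrite VE.
have -> : 11 * V * rho ^+ 3 = 11 * (K * rho) by rewrite -rhoV; ring.
(* (K rho)^2 = K^3/V: this is where k^3 <= V keeps the exponential bounded. *)
have Krho : K * rho <= 1.
  rewrite -ler_sqr ?nnegrE// ?mulr_ge0 ?(ltW rho0) ?(le_trans ler01)//.
  rewrite expr1n exprMn rho2 mulrA -exprSr ler_pdivrMr// mul1r (le_trans _ kV)//.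
  by rewrite lerXn2r ?nnegrE// (le_trans ler01).
have eS : expR (11 * (K * rho)) <= expR 11 by rewrite ler_expR; lra.
(* Substituting V rho^2 = K brings out rho^3, which offsets the 1/rho^3 of
   [coef_gauss_truncM_le]. *)
have -> : 7 * V * rho ^+ 5 + 120 * V ^+ 2 * rho ^+ 7
    + (11 * (K * rho)) ^+ 3 * expR (11 * (K * rho)) =
    (7 * K + 120 * K ^+ 2 + 1331 * expR (11 * (K * rho)) * K ^+ 3) * rho ^+ 3.
  move: (expR (11 * (K * rho))) => e; rewrite -rhoV; ring.
rewrite ler_wpM2r ?exprn_ge0 ?(ltW rho0)//.
have K3 : K ^+ 3 <= k%:R ^+ 3 by rewrite lerXn2r ?nnegrE// (le_trans ler01).
have K30 : 0 <= K ^+ 3 by rewrite exprn_ge0// (le_trans ler01).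
apply: (@le_trans _ _ (central_moment_const * K ^+ 3)); last first.
  rewrite ler_wpM2l//; rewrite /central_moment_const.
  by have := expR_ge0 (11 : R); lra.
have h1 : K <= K ^+ 3 by rewrite ler_eXnr.
have h2 : K ^+ 2 <= K ^+ 3 by rewrite ler_weXn2l.
have h3 := ler_wpM2r K30 eS.
rewrite /central_moment_const; move: (expR 11) (expR _) (K ^+ 2) (K ^+ 3) h1 h2 h3
  => e1 e2 K2' K3' h1 h2 h3; lra.
Qed.

End CentralMoment.

(** * Sums of independent Bernoulli variables *)

Section BernoulliSum.
Variables (R : realType) (I : finType) (q : I -> R).
Implicit Types (U W : {set I}) (j k : nat).

(** Probability that U is exactly the set of successful trials. *)
Definition bernoulli_weight U : R := \prod_i (if i \in U then q i else 1 - q i).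

Lemma eq_upto_prod_exp_trunc k (s : seq I) (y : I -> R) :
  eq_upto k (\prod_(i <- s) exp_trunc k (y i)) (exp_trunc k (\sum_(i <- s) y i)).
Proof.
elim: s => [|x s IH]; first by rewrite !big_nil exp_trunc0.
rewrite !big_cons; apply: eq_upto_trans (@exp_truncD _ _ _ _).
exact: eq_uptoM.
Qed.

Lemma card_sum_mem U : (\sum_i (i \in U))%N = #|U|.
Proof. by rewrite -sum1_card [RHS]big_mkcond/=; apply: eq_bigr => i _; case: ifP. Qed.

(** Distributing the product over the set U of successes, the exponentials for each U combine into
    exp((|U| - sum q_i) X). *)
Lemma coef_prod_bernoulli_truncE k :
  (\prod_i bernoulli_trunc k (q i))`_k =
  (\sum_(U : {set I}) bernoulli_weight U * (#|U|%:R - \sum_i q i) ^+ k) / k`!%:R.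
Proof.
rewrite /bernoulli_trunc bigA_distr coef_sum big_distrl/=.
apply: eq_big => // U _.
have -> : \prod_i (if i \in U then (q i)%:P * exp_trunc k (1 - q i)
      else (1 - q i)%:P * exp_trunc k (- q i)) =
    (bernoulli_weight U)%:P * \prod_i exp_trunc k ((i \in U)%:R - q i).
  rewrite rmorph_prod/= -big_split/=; apply: eq_bigr => i _.
  by case: ifP => _ //; rewrite sub0r.
rewrite coefCM (eq_upto_prod_exp_trunc _ _ (leqnn k)) coef_exp_trunc// -mulrA.
by rewrite sumrB -natr_sum card_sum_mem.
Qed.

Definition ffun_image j (f : {ffun 'I_j -> I}) : {set I} :=
  finset (fun i => i \in codom f).

Lemma card_ffun_image j (f : {ffun 'I_j -> I}) : (#|ffun_image f| <= j)%N.
Proof.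
rewrite cardsE (leq_trans (card_size _))// size_codom card_ord//.
Qed.

(** Probability that all trials in W succeed, read off by distributing a product whose failure terms
    are set to 0 on W. *)
Lemma sum_weight_sup W : \sum_(U : {set I} | W \subset U) bernoulli_weight U = \prod_(i in W) q i.
Proof.
have -> : \prod_(i in W) q i = \prod_i (q i + (if i \in W then 0 else 1 - q i)).
  rewrite big_mkcond/=; apply: eq_bigr => i _.
  by case: ifP => _; rewrite ?addr0// addrC subrK.
rewrite bigA_distr big_mkcond/=; apply: eq_big => // U _.
case: ifPn => [/fintype.subsetP WU|/fintype.subsetPn[i iW iU]].
  apply: eq_bigr => i _; case: ifPn => // iU.
  by case: ifPn => // /WU; rewrite (negbTE iU).
by rewrite (bigD1 i)//= (negbTE iU) iW mul0r.
Qed.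

(** The power expands over j-tuples of indices. Indicators are idempotent, so only the set of values
    of a tuple matters. *)
Lemma expr_sum_bool (X : pred I) j :
  ((\sum_i (X i : nat))%N)%:R ^+ j =
  \sum_(f : {ffun 'I_j -> I}) ([forall i, (i \in ffun_image f) ==> X i])%:R :> R.
Proof.
rewrite natr_sum -[in LHS](card_ord j) -prodr_const bigA_distr_bigA/=.
apply: eq_bigr => f _; rewrite -natr_prod.
congr (_%:R); case: forallP => [h|h].
  rewrite big1// => i _.
  by have := h (f i); rewrite inE codom_f/= => ->.
have [i Xi] : exists i, ~~ X (f i).
  apply/existsP; rewrite -negb_forall; apply/negP => /forallP h'; apply: h => x.
  by apply/implyP; rewrite inE => /codomP[i ->].
by rewrite (bigD1 i)//= (negbTE Xi) mul0n.
Qed.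

Lemma moment_weight j :
  \sum_(U : {set I}) bernoulli_weight U * #|U|%:R ^+ j =
  \sum_(f : {ffun 'I_j -> I}) \prod_(i in ffun_image f) q i.
Proof.
under eq_bigr => U _.
  rewrite -card_sum_mem (@expr_sum_bool (fun i => i \in U)) big_distrr/=; over.
rewrite exchange_big/=; apply: eq_bigr => f _.
rewrite -sum_weight_sup [RHS]big_mkcond/=; apply: eq_bigr => U _.
have -> : [forall i, (i \in ffun_image f) ==> (i \in U)] = (ffun_image f \subset U).
  apply/forallP/fintype.subsetP => h x; last by apply/implyP; exact: h.
  by move=> xf; have := h x; rewrite xf.
by case: ifP; rewrite ?mulr1 ?mulr0.
Qed.

(** A set U with |U| <= k is the image of at most |U|^j <= k^j tuples. *)
Lemma sum_ffun_image_le j k (g : {set I} -> R) : (j <= k)%N -> (forall U, 0 <= g U) ->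
  \sum_(f : {ffun 'I_j -> I}) g (ffun_image f) <=
  k%:R ^+ j * \sum_(U : {set I} | (#|U| <= k)%N) g U.
Proof.
move=> jk g0.
rewrite (partition_big (@ffun_image j) (fun U : {set I} => (#|U| <= k)%N))/=; last first.
  by move=> f _; rewrite (leq_trans (card_ffun_image f)).
rewrite big_distrr/=; apply: ler_sum => U Uk.
rewrite (eq_bigr (fun=> g U)); last by move=> f /eqP ->.
rewrite sumr_const -[leLHS]mulr_natl ler_wpM2r// -natrX ler_nat.
have cU : (#|@ffun_on 'I_j (mem U)| <= k ^ j)%N.
  by rewrite card_ffun_on card_ord; case: (j) => // j'; rewrite leq_exp2r.
apply: leq_trans cU.
apply/subset_leq_card/fintype.subsetP => f fU; have /eqP <- : ffun_image f == U by exact: fU.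
by apply/ffun_onP => i; rewrite inE codom_f.
Qed.

End BernoulliSum.

(** * From the sequence to the Bernoulli model *)

Section PrimeProducts.
Implicit Types (s : seq nat) (a p : nat).

Lemma prod_primes_gt0 s : all prime s -> (0 < \prod_(p <- s) p)%N.
Proof.
move=> /allP sp; rewrite big_seq; elim/big_rec: _ => // p n /sp /prime_gt0 p0 n0.
by rewrite muln_gt0 p0.
Qed.

(** The valuations being indicators, coprimality, square-freeness and the injectivity of
    [prime_prod] all follow from here. *)
Lemma logn_prod_primes p s : prime p -> all prime s -> uniq s ->
  logn p (\prod_(l <- s) l)%N = (p \in s).
Proof.
move=> pp; elim: s => [|l s IH] /=; first by rewrite big_nil logn1.
move=> /andP[lp sp] /andP[ls us]; rewrite big_cons lognM ?(prime_gt0 lp) ?prod_primes_gt0//.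
rewrite IH// logn_prime// in_cons.
by case: eqVneq => [->|_]; rewrite ?(negbTE ls).
Qed.

Lemma coprime_prod_primes p s : prime p -> all prime s -> uniq s -> p \notin s ->
  coprime p (\prod_(l <- s) l)%N.
Proof.
move=> pp sp us ps; rewrite prime_coprime//; apply/negP => pd.
have : (0 < logn p (\prod_(l <- s) l))%N.
  by rewrite logn_gt0 mem_primes pp prod_primes_gt0.
by rewrite logn_prod_primes// (negbTE ps).
Qed.

Lemma squarefree_prod_primes s : all prime s -> uniq s -> squarefree (\prod_(p <- s) p)%N.
Proof.
move=> sp us; have s0 := prod_primes_gt0 sp; split=> // m md.
have m0 : (0 < m)%N.
  by case: m md => //; rewrite exp0n// dvd0n => /eqP e; rewrite e in s0.
apply/eqP; rewrite eqn_leq m0 andbT leqNgt; apply/negP => m1.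
have pp := pdiv_prime m1.
have := dvdn_leq_log (pdiv m) s0 md; rewrite lognX logn_prod_primes//.
have : (0 < logn (pdiv m) m)%N by rewrite logn_gt0 mem_primes pp m0 pdiv_dvd.
by case: (logn _ _) => // e _; rewrite mulnS; case: (_ \in _).
Qed.

Lemma dvdn_prod_primes a s : all prime s -> uniq s ->
  (\prod_(p <- s) p %| a)%N = all (fun p => p %| a)%N s.
Proof.
elim: s => [|p s IH] /=; first by rewrite big_nil dvd1n.
move=> /andP[pp sp] /andP[ps us]; rewrite big_cons Gauss_dvd ?IH//.
exact: coprime_prod_primes.
Qed.

Lemma multiplicative_prod_primes (R : realType) (h : nat -> R) s :
  multiplicative_fun h -> all prime s -> uniq s ->
  h (\prod_(p <- s) p)%N / (\prod_(p <- s) p)%N%:R = \prod_(p <- s) (h p / p%:R).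
Proof.
move=> [h1 hM]; elim: s => [|p s IH] /=; first by rewrite !big_nil h1 divr1.
move=> /andP[pp sp] /andP[ps us]; rewrite !big_cons -IH// hM.
- by rewrite natrM invfM mulrACA.
- exact: prime_gt0.
- exact: prod_primes_gt0.
- exact: coprime_prod_primes.
Qed.

End PrimeProducts.

(** * Moments of [omega] over the sequence *)

Section SieveMoment.
Variables (R : realType) (P : {fset nat}) (h : nat -> R).
Hypothesis primeP : forall p, p \in P -> prime p.
Hypothesis hmul : multiplicative_fun h.
Implicit Types (U W : {set P}) (k : nat).

Let elts U : seq nat := [seq val i | i <- enum U].
Definition prime_prod U : nat := (\prod_(i in U) val i)%N.

Let prime_prodE U : prime_prod U = (\prod_(p <- elts U) p)%N.
Proof. by rewrite /prime_prod /elts big_map big_enum. Qed.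

Let mem_elts U (i : P) : (val i \in elts U) = (i \in U).
Proof. by rewrite mem_map ?mem_enum//; exact: val_inj. Qed.

Let elts_prime U : all prime (elts U).
Proof. by apply/allP => p /mapP[i _ ->]; exact: primeP (valP i). Qed.

Let elts_uniq U : uniq (elts U).
Proof. by rewrite map_inj_uniq ?enum_uniq//; exact: val_inj. Qed.

Lemma prime_prod_inj : injective prime_prod.
Proof.
move=> U W; rewrite !prime_prodE => UW; apply/setP => i.
have pi := primeP (valP i); rewrite -!mem_elts.
have := logn_prod_primes pi (elts_prime U) (elts_uniq U).
by rewrite UW logn_prod_primes//; do 2 case: (_ \in _).
Qed.

Lemma squarefree_prime_prod U : squarefree (prime_prod U).
Proof. by rewrite prime_prodE; exact: squarefree_prod_primes. Qed.

Lemma prime_prod_Dset U k : (#|U| <= k)%N -> Dset k P (prime_prod U).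
Proof.
move=> Uk; split; first exact: squarefree_prime_prod.
exists (elts U); split; last exact: prime_prodE.
- by rewrite size_map -cardE.
- by move=> p /mapP[i _ ->]; exact: valP.
Qed.

(** By [prime_prod_inj] distinct sets give distinct elements of [Dset k P], so no d is counted
    twice. *)
Lemma sum_prime_prod_le k (g : nat -> R) : (forall d, 0 <= g d) ->
  \sum_(U : {set P} | (#|U| <= k)%N) g (prime_prod U) <= \sum_(d \in Dset k P) g d.
Proof.
move=> g0; rewrite fsbig_finite; last exact: finite_Dset.
set D := fset_set _.
rewrite -[leLHS]big_filter; set t := seq.filter _ _; pose s := map prime_prod t.
have -> : \sum_(U <- t) g (prime_prod U) = \sum_(d <- s) g d by rewrite big_map.
have us : uniq s by rewrite map_inj_uniq ?filter_uniq ?index_enum_uniq//; exact: prime_prod_inj.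
have sD d : d \in s -> d \in D.
  move=> /mapP[U]; rewrite mem_filter => /andP[Uk _] ->.
  by rewrite in_fset_set ?inE; [exact: prime_prod_Dset|exact: finite_Dset].
rewrite [leRHS](bigID (fun d => d \in s))/= -[leLHS]addr0 lerD//; last first.
  by apply: sumr_ge0 => d _; exact: g0.
rewrite -[leRHS]big_filter le_eqVlt; apply/orP; left; apply/eqP/perm_big.
apply: uniq_perm => //; first by rewrite filter_uniq ?fset_uniq.
by move=> d; rewrite mem_filter; case: (boolP (d \in s)) => // /sD ->.
Qed.

Lemma omegaE a : omega P a = (\sum_(i : P) (val i %| a))%N.
Proof.
rewrite /omega big_mkcond big_seq_fsetE/=.
by apply: eq_bigr => i _; case: ifP.
Qed.

Variables (A : seq nat) (N : R) (r : nat -> R).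
Hypothesis sieve_axiom : forall d, squarefree d ->
  (count (fun a => d %| a)%N A)%:R = h d / d%:R * N + r d.

Let q (i : P) : R := h (val i) / (val i)%:R.

(** For each tuple, divisibility by all its primes is divisibility by the square-free product of the
    distinct ones, which the sieve assumption counts; the main parts add up to the model moment of
    [moment_weight]. *)
Lemma sum_omega_expr j :
  \sum_(a <- A) (omega P a)%:R ^+ j =
  N * \sum_(U : {set P}) bernoulli_weight q U * #|U|%:R ^+ j +
  \sum_(f : {ffun 'I_j -> P}) r (prime_prod (ffun_image f)).
Proof.
under eq_bigr => a _ do
  rewrite omegaE (@expr_sum_bool R _ (fun i : P => val i %| a)%N).
rewrite exchange_big/= moment_weight big_distrr/= -big_split/=.
apply: eq_bigr => f _; set U := ffun_image f.
rewrite mulrC -[X in X * N](_ : h (prime_prod U) / (prime_prod U)%:R = _); last first.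
  rewrite !prime_prodE multiplicative_prod_primes//.
  by rewrite big_map big_enum.
rewrite -sieve_axiom; last exact: squarefree_prime_prod.
rewrite -natr_sum -sum1_count [in RHS]big_mkcond/=; congr (_%:R).
apply: eq_bigr => a _; rewrite prime_prodE dvdn_prod_primes//.
have -> : all (fun p => p %| a)%N (elts U) = [forall i, (i \in U) ==> (val i %| a)%N].
  apply/allP/forallP => [H i|H p /mapP[i iU ->]].
    by apply/implyP => iU; apply: H; rewrite mem_elts.
  by have := H i; rewrite -(mem_enum U) iU.
by case: ifP.
Qed.

(** Both k-th powers are expanded around 0. The j-th remainder costs at most k^j sum |r_d|, and the
    binomial theorem resums these bounds to (mu + k)^k. *)
Lemma sieve_moment k : 0 <= mu h P ->
  `|\sum_(a <- A) ((omega P a)%:R - mu h P) ^+ k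
    - N * \sum_(U : {set P}) bernoulli_weight q U * (#|U|%:R - \sum_i q i) ^+ k|
  <= (mu h P + k%:R) ^+ k * \sum_(d \in Dset k P) `|r d|.
Proof.
move=> mu0; have -> : \sum_i q i = mu h P by rewrite /mu big_seq_fsetE.
set m := mu h P.
have binomial (x : R) : (x - m) ^+ k = \sum_(j < k.+1) (- m) ^+ (k - j) * 'C(k, j)%:R * x ^+ j.
  rewrite addrC exprDn; apply: eq_bigr => j _.
  by rewrite -mulr_natr mulrAC.
under eq_bigr => a _ do rewrite binomial.
under [X in N * X]eq_bigr => U _ do rewrite binomial big_distrr/=.
rewrite exchange_big/= [X in N * X]exchange_big/= big_distrr/= -sumrB.
apply: (@le_trans _ _ (\sum_(j < k.+1) m ^+ (k - j) * 'C(k, j)%:R *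
    (k%:R ^+ j * \sum_(d \in Dset k P) `|r d|))); last first.
  rewrite le_eqVlt; apply/orP; left; apply/eqP.
  rewrite exprDn big_distrl/=; apply: eq_bigr => j _.
  by rewrite -[X in _ = X * _]mulr_natr; ring.
rewrite (le_trans (ler_norm_sum _ _ _))//; apply: ler_sum => j _.
have jk : (j <= k)%N by rewrite -ltnS.
rewrite -big_distrr/= sum_omega_expr.
under [X in _ - N * X]eq_bigr => U _ do rewrite mulrCA.
(* The main parts of order [j] cancel; only the remainders r_d survive. *)
rewrite -big_distrr/= mulrDr mulrCA addrAC subrr add0r !normrM normrX normrN.
rewrite (ger0_norm mu0) ger0_norm// ler_wpM2l ?mulr_ge0 ?exprn_ge0//.
rewrite (le_trans (ler_norm_sum _ _ _))//.
have := @sum_ffun_image_le R P j k (fun U => `|r (prime_prod U)|) jk (fun=> normr_ge0 _).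
move/le_trans; apply; rewrite ler_wpM2l ?exprn_ge0//.
by apply: (@sum_prime_prod_le k (fun d => `|r d|)) => d.
Qed.

End SieveMoment.

(** * The central moment in terms of [sigma] and [mu] *)

Section CentralMomentAsymptotics.
Variables (R : realType) (P : {fset nat}) (h : nat -> R) (k : nat) (c1 : R).
Hypothesis q_half : forall p, p \in P -> 0 <= h p / p%:R <= 1 / 2.
Hypothesis k_ge3 : (3 <= k)%N.
Hypothesis k_odd : odd k.
Hypothesis k_sigma : k%:R <= sigma h P `^ (2 / 3).
Hypothesis sigma_tilde_le : sigma_tilde h P <= c1.

Let q (i : P) : R := h (val i) / (val i)%:R.
Let V : R := \sum_i q i * (1 - q i).

Let qP i : 0 <= q i <= 1 / 2.
Proof. exact: q_half (valP i). Qed.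

Let sigmaE : sigma h P = Num.sqrt V.
Proof. by rewrite /sigma /V big_seq_fsetE. Qed.

Let V_ge0 : 0 <= V.
Proof.
apply: sumr_ge0 => i _; have /andP[q0 q1] := qP i.
by rewrite mulr_ge0// subr_ge0; lra.
Qed.

Let sigma_sqr : sigma h P ^+ 2 = V.
Proof. by rewrite sigmaE sqr_sqrtr. Qed.

Lemma k_cube_le_sigma_sqr : k%:R ^+ 3 <= sigma h P ^+ 2.
Proof.
have s0 : 0 <= sigma h P by rewrite sqrtr_ge0.
have -> : sigma h P ^+ 2 = (sigma h P `^ (2 / 3)) ^+ 3.
  rewrite -[RHS]powR_mulrn ?powR_ge0// -powRrM -[LHS]powR_mulrn//.
  by congr (_ `^ _); field.
by rewrite lerXn2r ?nnegrE ?powR_ge0.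
Qed.

Lemma sigma_sqr_le_mu : sigma h P ^+ 2 <= mu h P.
Proof.
rewrite sigma_sqr /mu big_seq_fsetE; apply: ler_sum => i _.
by have /andP[q0 q1] := qP i; rewrite -/(q i) ler_piMr//; lra.
Qed.

(** (1 + k/mu)^k <= exp(k^2/mu) <= e, because k^2 <= mu. *)
Lemma mu_add_expr_le : (mu h P + k%:R) ^+ k <= expR 1 * mu h P ^+ k.
Proof.
have k1 : 1 <= k%:R :> R by rewrite ler1n (leq_trans _ k_ge3).
have mu_ge : k%:R ^+ 2 <= mu h P.
  apply: le_trans sigma_sqr_le_mu; apply: le_trans k_cube_le_sigma_sqr.
  by rewrite ler_weXn2l.
have mu0 : 0 < mu h P by apply: lt_le_trans mu_ge; rewrite exprn_gt0// (lt_le_trans ltr01).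
have -> : mu h P + k%:R = (1 + k%:R / mu h P) * mu h P.
  by rewrite mulrDl mul1r divfK// gt_eqF.
rewrite exprMn ler_wpM2r// ?exprn_ge0 ?(ltW mu0)//.
apply: (@le_trans _ _ (expR (k%:R / mu h P) ^+ k)).
  rewrite lerXn2r ?nnegrE ?expR_ge0 ?expR_ge1Dx//.
  by rewrite addr_ge0// divr_ge0// ltW.
rewrite -expRM_natl ler_expR mulrA -expr2 ler_pdivrMr// mul1r//.
Qed.

Lemma central_moment_asymp :
  `|\sum_(U : {set P}) bernoulli_weight q U * (#|U|%:R - \sum_i q i) ^+ k
    - momentCtilde R k * sigma h P ^+ (k - 1)|
  <= 7 * (central_moment_const R + c1 ^+ 2) *
     ((k%:R `^ (3 / 2) * momentC R k) * sigma h P ^+ (k - 3) * k%:R ^+ 3).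
Proof.
have [n kE] : exists n, k = n.*2.+3.
  exists (k - 3)./2; rewrite even_halfK; last by rewrite oddB// k_odd.
  by rewrite -addn3 subnK.
have kV : n.*2.+3%:R ^+ 3 <= V by rewrite -kE -sigma_sqr k_cube_le_sigma_sqr.
have fE : k`!%:R != 0 :> R by rewrite pnatr_eq0 -lt0n fact_gt0.
have coefE := coef_prod_bernoulli_truncE q k.
set E := \sum_U _ in coefE *.
have {coefE}-> : E = k`!%:R * (\prod_i bernoulli_trunc k (q i))`_k.
  by rewrite coefE mulrC divfK.
have := coef_prod_bernoulli_trunc qP (n := n) (s := index_enum _) kV.
rewrite -kE -/V; set a := (V / 2) ^+ n / _; set c := _`_k => hc.
have tau_le : \sum_i q i ^+ 2 * (1 - q i) <= c1 ^+ 2.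
  set tau := \sum_i _.
  have tau0 : 0 <= tau.
    apply: sumr_ge0 => i _; have /andP[q0 q1] := qP i.
    by rewrite mulr_ge0 ?sqr_ge0// subr_ge0; lra.
  have st : sigma_tilde h P = Num.sqrt tau by rewrite /sigma_tilde /tau big_seq_fsetE.
  rewrite -(sqr_sqrtr tau0) -st lerXn2r ?nnegrE// ?st ?sqrtr_ge0//.
  by rewrite (le_trans _ sigma_tilde_le)// st sqrtr_ge0.
(* The second sum is the square of [sigma_tilde], bounded by c1^2; since k^3 >= 1 its contribution
   joins the error term. *)
have kappaE : \sum_i q i * (1 - q i) * (1 - 2 * q i) / 6 =
    V / 6 - (\sum_i q i ^+ 2 * (1 - q i)) / 3.
  by rewrite /V !big_distrl/= -sumrB; apply: eq_bigr => i _; field.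
rewrite kappaE in hc; set tau := \sum_i _ in tau_le hc.
have tau0 : 0 <= tau.
  apply: sumr_ge0 => i _; have /andP[q0 q1] := qP i.
  by rewrite mulr_ge0 ?sqr_ge0// subr_ge0; lra.
have a0 : 0 <= a by rewrite divr_ge0// exprn_ge0// divr_ge0.
have k31 : 1 <= k%:R ^+ 3 :> R by rewrite exprn_ege1// ler1n (leq_trans _ k_ge3).
have sigma_even m : sigma h P ^+ m.*2 = V ^+ m by rewrite -mul2n exprM sigma_sqr.
have -> : (k - 3)%N = n.*2 by rewrite kE !subSS subn0.
have -> : (k - 1)%N = n.+1.*2 by rewrite kE subSS subn0.
rewrite !sigma_even.
(* An exact identity: the stated main term costs no further error. *)
have -> : momentCtilde R k * V ^+ n.+1 = k`!%:R * (a * (V / 6)).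
  rewrite /a kE momentCtilde_odd expr_div_n exprS.
  have n0 : n`!%:R != 0 :> R by rewrite pnatr_eq0 -lt0n fact_gt0.
  have p0 : 2 ^+ n != 0 :> R by rewrite expf_neq0.
  move: (2 ^+ n) (n`!%:R : R) (_`!%:R : R) n0 p0 => x y z y0 x0; field.
  by rewrite x0 y0.
rewrite -mulrBr normrM normr_nat.
have {}hc : `|c - a * (V / 6)| <= (central_moment_const R + c1 ^+ 2) * (k%:R ^+ 3 * a).
  have -> : c - a * (V / 6) = (c - a * (V / 6 - tau / 3)) - a * tau / 3 by field.
  rewrite (le_trans (ler_normB _ _))// mulrDl lerD//.
  rewrite ger0_norm; last by rewrite divr_ge0// mulr_ge0.
  have : a * tau <= c1 ^+ 2 * (k%:R ^+ 3 * a).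
    rewrite mulrA [leRHS]mulrC ler_wpM2l// (le_trans tau_le)// ler_peMr// sqr_ge0//.
  have := mulr_ge0 a0 tau0; lra.
apply: (@le_trans _ _ (k`!%:R * ((central_moment_const R + c1 ^+ 2) * (k%:R ^+ 3 * a)))).
  by rewrite ler_wpM2l.
have C0 : 0 <= central_moment_const R + c1 ^+ 2.
  rewrite /central_moment_const; have := expR_ge0 (11 : R).
  by have := sqr_ge0 c1; lra.
have aE : k`!%:R * a = k`!%:R / (2 ^+ n * n`!%:R) * V ^+ n.
  by rewrite /a expr_div_n invfM -!mulrA; congr (_ * _); rewrite mulrC -mulrA.
have h1 : k`!%:R * a <= 7 * (k%:R `^ (3 / 2) * momentC R k) * V ^+ n.
  by rewrite aE ler_wpM2r ?exprn_ge0// kE momentC_odd_ge.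
rewrite [leLHS](_ : _ = (central_moment_const R + c1 ^+ 2) * k%:R ^+ 3 * (k`!%:R * a)); last by ring.
rewrite [leRHS](_ : _ = (central_moment_const R + c1 ^+ 2) * k%:R ^+ 3 *
  (7 * (k%:R `^ (3 / 2) * momentC R k) * V ^+ n)); last by ring.
by rewrite ler_wpM2l// mulr_ge0// exprn_ge0.
Qed.

End CentralMomentAsymptotics.

(** Uniformity lies in the order of the quantifiers: [M] is chosen before the sequences, the prime
    sets, [h] and the exponents. *)
Theorem proposition4p2 (R : realType) (c1 K : R) (hc1 : 0 < c1) (hK : 0 < K) :
  exists2 M : R, 0 < M &
  forall (A : R -> seq nat) (P : R -> {fset nat})
         (h : nat -> R) (N : R -> R) (r : nat -> R -> R)
         (k pstar lstar : R -> nat),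
  (* the sequences A(x), the sets of primes P(z), the exponents k(z) *)
  ((size (A x))%:R : R) @[x --> +oo%R] --> +oo%R ->
  (forall z : R, 1 <= z -> forall p : nat, p \in P z -> prime p) ->
  ((#|` P z|)%:R : R) @[z --> +oo%R] --> +oo%R ->
  (forall z : R, 1 <= z -> (3 <= k z)%N /\ odd (k z)) ->
  (* 1 *)
  multiplicative_fun h ->
  (forall n : nat, (1 <= n)%N -> 0 <= h n <= n%:R) ->
  (forall x : R, 1 <= x -> 0 < N x) ->
  (forall x y : R, 1 <= x -> x <= y -> N x <= N y) ->
  (forall (x : R) (d : nat), 1 <= x -> squarefree d ->
     (count (fun a => d %| a)%N (A x))%:R = h d / d%:R * N x + r d x) ->
  (* 2 *)
  sigma h (P z) @[z --> +oo%R] --> +oo%R ->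
  (* 3 *)
  (\forall z \near +oo%R, (k z)%:R <= sigma h (P z) `^ (2 / 3)) ->
  (* 4 *)
  (forall z : R, 1 <= z -> forall p : nat, p \in P z ->
     0 <= h p / p%:R <= 1 / 2) ->
  (* 5 *)
  (\forall z \near +oo%R,
     [/\ pstar z \in P z,
         forall p q : nat, p \in P z -> q \in P z ->
           (pstar z <= p)%N -> (p <= q)%N ->
           h q / q%:R * (1 - h q / q%:R) * (1 - 2 * (h q / q%:R))
           <= h p / p%:R * (1 - h p / p%:R) * (1 - 2 * (h p / p%:R))
       & ((k z - 1) %/ 2 <= #|` [fset p in P z | (pstar z <= p)%N]%fset|)%N]) ->
  (* 6 *)
  (\forall z \near +oo%R,
     [/\ pstar z = nth_smallest (P z) (lstar z),
         nth_smallest (P z) (lstar z + (k z - 3) %/ 2) \in P z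
       & (lstar z)%:R <= K * (k z)%:R]) ->
  (* 7 *)
  (forall z : R, 1 <= z -> sigma_tilde h (P z) <= c1) ->
  exists x0 z0 : R, forall x z : R, 1 <= x -> x0 <= x -> 1 <= z -> z0 <= z ->
    `| \sum_(a <- A x) ((omega (P z) a)%:R - mu h (P z)) ^+ k z
       - momentCtilde R (k z) * N x * sigma h (P z) ^+ (k z - 1) |
    <= M * (((k z)%:R `^ (3 / 2) * momentC R (k z)) * N x
              * sigma h (P z) ^+ (k z - 3) * (k z)%:R ^+ 3)
       + M * (mu h (P z) ^+ k z * \sum_(d \in Dset (k z) (P z)) `| r d x |).
Proof.
exists (7 * (central_moment_const R + c1 ^+ 2) + expR 1).
  have := expR_gt0 (1 : R); have := expR_gt0 (11 : R); have := sqr_ge0 c1.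
  by rewrite /central_moment_const; lra.
move=> A P h N r k pstar lstar _ primeP _ kodd hmul _ N0 _ sieve _ ksig qhalf _ _ st.
have [z1 [_ z1P]] := ksig.
(* Neighbourhoods of +oo are given by strict inequalities z1 < z, hence the shift by 1. *)
exists 1, (z1 + 1) => x z x1 _ zge1 z0.
have {z1P z0}kz : (k z)%:R <= sigma h (P z) `^ (2 / 3).
  by apply: z1P; apply: lt_le_trans z0; rewrite ltrDl.
have [k3 ko] := kodd z zge1.
have mu0 : 0 <= mu h (P z).
  exact: le_trans (sqr_ge0 _) (sigma_sqr_le_mu (qhalf z zge1)).
have Nx := N0 x x1.
have main := sieve_moment (primeP z zge1) hmul (fun d => sieve x d x1) (k z) mu0.
have cm := central_moment_asymp (qhalf z zge1) k3 ko kz (st z zge1).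
have me := mu_add_expr_le (qhalf z zge1) k3 kz.
move: main cm; set E := \sum_U _; set Sm := \sum_(a <- A x) _.
set D := \sum_(d \in _) _; set X := _ `^ _ * _ * _ * _ => main cm.
have D0 : 0 <= D by apply: fsumr_ge0.
have C0 : 0 <= 7 * (central_moment_const R + c1 ^+ 2).
  by rewrite /central_moment_const; have := expR_gt0 (11 : R); have := sqr_ge0 c1; lra.
have X0 : 0 <= X.
  (* [cm] bounds an absolute value by a positive constant times [X], which forces X >= 0. *)
  rewrite -(pmulr_rge0 _ (lt_le_trans ltr01 (_ : 1 <= 7 * (central_moment_const R + c1 ^+ 2)))).
    exact: le_trans (normr_ge0 _) cm.
  by rewrite /central_moment_const; have := expR_gt0 (11 : R); have := sqr_ge0 c1; lra.
have -> : Sm - momentCtilde R (k z) * N x * sigma h (P z) ^+ (k z - 1) =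
    (Sm - N x * E) + N x * (E - momentCtilde R (k z) * sigma h (P z) ^+ (k z - 1)) by ring.
rewrite (le_trans (ler_normD _ _))// addrC lerD//.
- rewrite normrM (gtr0_norm Nx).
  apply: (@le_trans _ _ (N x * (7 * (central_moment_const R + c1 ^+ 2) * X))).
    by rewrite ler_pM2l.
  rewrite [leRHS](_ : _ = N x * ((7 * (central_moment_const R + c1 ^+ 2) + expR 1) * X)); last first.
    by rewrite /X; ring.
  by rewrite ler_pM2l// ler_wpM2r// lerDl expR_ge0.
- apply: (le_trans main); apply: (@le_trans _ _ (expR 1 * mu h (P z) ^+ k z * D)).
    by rewrite ler_wpM2r.
  rewrite -mulrA ler_wpM2r// ?lerDr//.
  by rewrite mulr_ge0// exprn_ge0.
Qed.
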